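(* Let $k$ be a field and let $K$ be a simplicial complex on the vertex set $[m]$. The Stanley--Reisner ideal $I_K$ is a quasi-Koszul $S$-module, where $S=k[v_1,\ldots,v_m]$, if and only if $K$ is an HMF complex over $k$.
   Context: A simplicial complex $K$ on $[m]=\{1,\ldots,m\}$ is a nonempty collection of subsets of $[m]$ closed under passing to subsets, with $\{i\}\in K$ for all $i\in[m]$. For $U\subseteq[m]$, $K_U=\{\sigma\in K:\sigma\subseteq U\}$. A minimal non-face (missing face) is a subset $I\notin K$ all of whose proper subsets lie in $K$. $S$ is standard graded and $I_K=(v_{i_1}\cdots v_{i_q}:\{i_1,\ldots,i_q\}\notin K)$. A finitely generated graded $S$-module $M$ is *quasi-Koszul* if $\operatorname{Ext}_S(M,k)$ is generated by $\operatorname{Ext}^0_S(M,k)$ under the Yoneda action of the exterior algebra $\operatorname{Ext}_S(k,k)$. $K$ is a *homology missing face complex* (HMF complex) over $k$ if for each nonempty $U\subseteq[m]$, $\widetilde H_*(K_U;k)$ is generated as a $k$-module by missing faces of $K$, i.e. by the images in homology of the inclusions $K_I\hookrightarrow K_U$ for minimal non-faces $I\notin K$ with $I\subseteq U$. *)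

(* Defs.v *)
From HB Require Import structures.
From mathcomp Require Import all_boot all_order all_algebra.
From mathcomp Require Import boolp.
From mathcomp Require Import mpoly.

Set Implicit Arguments.
Unset Strict Implicit.
Unset Printing Implicit Defensive.

Import GRing.Theory.
Local Open Scope ring_scope.

Section Ext.
Variable R : comNzRingType.

Definition projective (P : lmodType R) : Prop :=
  forall (A B : lmodType R) (g : {linear A -> B}) (f : {linear P -> B}),
    (forall b, exists a, g a = b) ->
    exists h : {linear P -> A}, forall x, g (h x) = f x.

(* ... -> P_2 -> P_1 -> P_0 -> M -> 0, with res_diff n : P_(n+1) -> P_n. *)
Record proj_resolution (M : lmodType R) := ProjResolution {
  res_mod :> nat -> lmodType R;
  res_diff : forall n, {linear res_mod n.+1 -> res_mod n};
  res_aug : {linear res_mod 0 -> M};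
  res_proj : forall n, projective (res_mod n);
  res_exact : forall n x,
    res_diff n x = 0 <-> exists y, res_diff n.+1 y = x;
  res_exact0 : forall x, res_aug x = 0 <-> exists y, res_diff 0 y = x;
  res_surj : forall z, exists x, res_aug x = z
}.

(* Ext^n(M, N) is H^n(Hom(P, N)) for a projective resolution P of M: the      *)
(* module of cocycles P_n -> N modulo coboundaries.                           *)
Section Cochains.
Variables (M N : lmodType R) (P : proj_resolution M).

Definition cocycle n (phi : {linear P n -> N}) : Prop :=
  forall x, phi (res_diff P n x) = 0.

Definition coboundary n : (P n -> N) -> Prop :=
  match n with
  | 0 => fun phi => forall x, phi x = 0
  | n'.+1 => fun phi =>
      exists chi : {linear P n' -> N}, forall x, phi x = chi (res_diff P n' x)
  end.

Definition cohomologous n (phi psi : P n -> N) : Prop :=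
  coboundary (fun x => phi x - psi x).

End Cochains.

Section Yoneda.
Variables (M N L : lmodType R) (P : proj_resolution M) (Q : proj_resolution N).

(* A chain map P_(j + -) -> Q over phi : P_j -> N. *)
Definition chain_lift j (phi : {linear P j -> N})
    (f : forall i, {linear P (i + j)%N -> Q i}) : Prop :=
  (forall x, res_aug Q (f 0 x) = phi x) /\
  (forall i x, res_diff Q i (f i.+1 x) = f i (res_diff P (i + j)%N x)).

(* The class of gamma in Ext^(i+j)(M, L) is the Yoneda product of the class   *)
(* of psi in Ext^i(N, L) and the class of phi in Ext^j(M, N).                 *)
Definition yoneda_product i j (psi : {linear Q i -> L})
    (phi : {linear P j -> N}) (gamma : {linear P (i + j)%N -> L}) : Prop :=
  exists2 f, chain_lift phi f &
    cohomologous gamma (fun x => psi (f i x)).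

End Yoneda.

(* Ext(M, N) = Ext(N, N) . Ext^0(M, N): as the generators lie in degree 0,    *)
(* a class of degree n (here displayed as n + 0) has to be a finite sum of    *)
(* products of elements of Ext^n(N, N) with elements of Ext^0(M, N).          *)
Definition ext_generated_in_degree0 (M N : lmodType R)
    (P : proj_resolution M) (Q : proj_resolution N) : Prop :=
  forall n (gamma : {linear P (n + 0)%N -> N}), cocycle gamma ->
    exists (r : nat) (psi : 'I_r -> {linear Q n -> N})
           (phi : 'I_r -> {linear P 0 -> N})
           (delta : 'I_r -> {linear P (n + 0)%N -> N}),
      (forall l, [/\ cocycle (psi l), cocycle (phi l) &
                     yoneda_product (psi l) (phi l) (delta l)]) /\
      cohomologous gamma (fun x => \sum_(l < r) delta l x).

End Ext.

Section StanleyReisner.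
Variables (k : fieldType) (m : nat).
Local Notation S := {mpoly k[m]}.

(* The S-module k = S / (v_1, ..., v_m). *)
Definition residue_field : Type := k.
HB.instance Definition _ := GRing.Zmodule.on residue_field.

Definition residue_scale (p : S) (a : residue_field) : residue_field :=
  p.@[fun=> 0] * (a : k).

Fact residue_scaleA p q a :
  residue_scale p (residue_scale q a) = residue_scale (p * q) a.
Proof. by rewrite /residue_scale mevalM mulrA. Qed.

Fact residue_scale1 : left_id 1 residue_scale.
Proof. by move=> a; rewrite /residue_scale meval1 mul1r. Qed.

Fact residue_scaleDr : right_distributive residue_scale +%R.
Proof. by move=> p a b; rewrite /residue_scale mulrDr. Qed.

Fact residue_scaleDl a : {morph residue_scale^~ a : p q / p + q}.
Proof. by move=> p q; rewrite /residue_scale mevalD mulrDl. Qed.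

HB.instance Definition _ := GRing.Zmodule_isLmodule.Build S residue_field
  residue_scaleA residue_scale1 residue_scaleDr residue_scaleDl.

(* The two resolutions are arbitrary, since neither Ext nor the Yoneda        *)
(* product depends on them.                                                   *)
Definition quasi_koszul (M : lmodType S) : Prop :=
  forall (P : proj_resolution M) (Q : proj_resolution (residue_field : lmodType S)),
    ext_generated_in_degree0 P Q.

Definition simplicial_complex (K : {set {set 'I_m}}) : Prop :=
  [/\ K != set0,
      forall s t : {set 'I_m}, s \in K -> t \subset s -> t \in K &
      forall i : 'I_m, [set i] \in K].

Definition stanley_reisner (K : {set {set 'I_m}}) : {pred S^o} :=
  fun p => `[< exists q : {set 'I_m} -> S,
    p = \sum_(s : {set 'I_m} | s \notin K) q s * \prod_(i in s) 'X_i >].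

Fact stanley_reisner_submod K : submod_closed (stanley_reisner K).
Proof.
split.
  by apply/asboolP; exists (fun=> 0); rewrite big1 // => s _; rewrite mul0r.
move=> a u v /asboolP[q ->] /asboolP[q' ->]; apply/asboolP.
exists (fun s => a * q s + q' s).
rewrite scaler_sumr -big_split /=; apply: eq_bigr => s _.
by rewrite mulrDl -mulrA.
Qed.

HB.instance Definition _ K := GRing.isSubmodClosed.Build S S^o
  (stanley_reisner K) (stanley_reisner_submod K).

(* The Stanley-Reisner ideal as an S-module. *)
Record SR_ideal (K : {set {set 'I_m}}) := SRIdeal {
  SR_val :> S^o;
  SR_valP : SR_val \in stanley_reisner K
}.

HB.instance Definition _ K := [isSub for @SR_val K].
HB.instance Definition _ K := [Choice of SR_ideal K by <:].
HB.instance Definition _ K := [SubChoice_isSubLmodule of SR_ideal K by <:].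

End StanleyReisner.

Section HMF.
Variables (k : fieldType) (m : nat).
Implicit Types (K : {set {set 'I_m}}) (s U I : {set 'I_m}).

Definition full_subcomplex K U : {set {set 'I_m}} := [set s in K | s \subset U].

Definition missing_face K I : bool :=
  (I \notin K) && [forall J : {set 'I_m}, (J \proper I) ==> (J \in K)].

(* Simplices are oriented by the order of the vertices.  The chains of all    *)
(* dimensions, including the empty simplex in dimension -1, live in one       *)
(* space, so that the homology below is reduced.                              *)
Local Notation chain := {ffun {set 'I_m} -> k^o}.

Definition simplex s : chain := [ffun t => (t == s)%:R].

Definition boundary (c : chain) : chain :=
  \sum_(s : {set 'I_m}) c s *:
    (\sum_(i in s) (-1) ^+ #|[set j in s | (j < i)%N]| *: simplex (s :\ i)).

Fact boundary_linear : linear boundary.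
Proof.
move=> a c d; rewrite /boundary scaler_sumr -big_split /=.
by apply: eq_bigr => s _; rewrite !ffunE scalerDl scalerA.
Qed.

HB.instance Definition _ :=
  GRing.isLinear.Build k chain chain _ boundary boundary_linear.

(* Indexed by the number n of vertices, i.e. in dimension n - 1. *)
Definition chains K (n : nat) : {vspace chain} :=
  <<[seq simplex s | s in [set s in K | #|s| == n]]>>%VS.

Definition cycles K n : {vspace chain} :=
  (chains K n :&: lker (linfun boundary))%VS.

Definition boundaries K n : {vspace chain} :=
  (linfun boundary @: chains K n.+1)%VS.

(* The homology of K_U is cycles modulo boundaries; the right hand side is    *)
(* the preimage in the chains of the sum of the images of the homology of the *)
(* K_I.                                                                       *)
Definition HMF K : Prop :=
  forall U, U != set0 -> forall n,
    (cycles (full_subcomplex K U) n <=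
       boundaries (full_subcomplex K U) n +
       \sum_(I : {set 'I_m} | missing_face K I && (I \subset U))
          cycles (full_subcomplex K I) n)%VS.

End HMF.

(* Main.v *)
(* Over S = k[v_1, ..., v_m] the group Ext^n_S(M, k) is the k-dual of             *)
(* Tor_n^S(M, k), which is the homology of the Koszul complex of M: zigzagging   *)
(* through the double complex formed by the Koszul complexes of a projective     *)
(* resolution of M turns a Koszul cycle over M into an element of P_n, on which  *)
(* cocycles can be evaluated.  Under this pairing the products of Ext^n(k, k)    *)
(* with Ext^0(M, k) are the functionals on Tor_n(M, k) that factor through       *)
(* Lambda^n (x) M/mM, so M is quasi-Koszul iff every Koszul cycle with           *)
(* coefficients in mM is a boundary.                                             *)
(*                                                                               *)
(* For M = I_K the Koszul complex splits by multidegree.  It is exact in the     *)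
(* multidegrees that are not squarefree, and in the multidegree of a vertex set  *)
(* U it is, after A |-> U \ A, the complex of relative cochains of K_U in the    *)
(* full simplex on U; the coefficients outside mM sit on the missing faces.      *)
(* So the condition says that a relative cocycle vanishing on the missing faces  *)
(* is a coboundary.  By linear duality this means that the relative homology is  *)
(* spanned by the missing faces, and the connecting isomorphism carries it to    *)
(* the reduced homology of K_U.                                                  *)

From HB Require Import structures.
Require Import Defs.
From mathcomp Require Import all_boot all_order all_algebra.
From mathcomp Require Import boolp.
From mathcomp Require classical_sets.
From mathcomp Require Import mpoly freeg ring.

Set Implicit Arguments.
Unset Strict Implicit.
Unset Printing Implicit Defensive.

Import GRing.Theory.
Local Open Scope ring_scope.

(** * Koszul complexes *)

Section KoszulComplex.
Variables (m : nat).
Implicit Types (A B : {set 'I_m}) (i j : 'I_m).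

Definition kos_sign A i : bool := odd #|[set j in A | (j < i)%N]|.

Lemma kos_signU A i j : i \notin A ->
  kos_sign (i |: A) j = (i < j)%N (+) kos_sign A j.
Proof.
move=> iA; rewrite /kos_sign; case: ltnP => ij /=.
  rewrite (_ : [set _ in _ | _] = i |: [set j0 in A | (j0 < j)%N]).
    by rewrite cardsU1 !inE (negPf iA) /= oddD.
  by apply/setP=> l; rewrite !inE andb_orl; case: (eqVneq l i) => // ->; rewrite ij.
congr (odd #|pred_of_set _|); apply/setP=> l; rewrite !inE andb_orl.
by case: (eqVneq l i) => // ->; rewrite ltnNge ij (negPf iA).
Qed.

Lemma kos_signU2 A i j : i \notin A -> j \notin A -> i != j ->
  kos_sign A i (+) kos_sign (i |: A) j = ~~ (kos_sign A j (+) kos_sign (j |: A) i).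
Proof.
move=> iA jA ij; rewrite !kos_signU //.
have -> : (j < i)%N = ~~ (i < j)%N by rewrite -leqNgt ltn_neqAle eq_sym ij.
by case: (_ < _)%N; case: (kos_sign A i); case: (kos_sign A j).
Qed.

Section Differential.
Variables (R : comNzRingType) (x : 'I_m -> R).

(* The tensor product of the exterior algebra on e_1, ..., e_m with N: the value *)
(* at A is the coefficient of the product of the e_i for i in A.                 *)
Local Notation kos N := {ffun {set 'I_m} -> N}.

Definition kd (N : lmodType R) (z : kos N) : kos N :=
  [ffun A : {set 'I_m} =>
     \sum_(i | i \notin A) (-1) ^+ kos_sign A i *: (x i *: z (i |: A))].

(* Exterior multiplication by e_j. *)
Definition kos_wedge (N : lmodType R) j (z : kos N) : kos N :=
  [ffun A : {set 'I_m} =>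
     if j \in A then (-1) ^+ kos_sign (A :\ j) j *: z (A :\ j) else 0].

Lemma kd_linear (N : lmodType R) : linear (@kd N).
Proof.
move=> a z w; apply/ffunP=> A; rewrite !ffunE scaler_sumr -big_split /=.
apply: eq_bigr => i _; rewrite !ffunE !scalerDr !scalerA; congr (_ *: _ + _).
by rewrite mulrC mulrA.
Qed.
HB.instance Definition _ (N : lmodType R) :=
  GRing.isLinear.Build R {ffun {set 'I_m} -> N} {ffun {set 'I_m} -> N} _
    (@kd N) (@kd_linear N).

Lemma kdZ (N : lmodType R) a (z : kos N) : kd (a *: z) = a *: kd z.
Proof. exact: linearZ_LR. Qed.

Lemma kd_kd (N : lmodType R) (z : kos N) : kd (kd z) = 0.
Proof.
apply/ffunP=> A; rewrite !ffunE.
pose F i j := (-1) ^+ (kos_sign A i (+) kos_sign (i |: A) j) *: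
   ((x i * x j) *: z (j |: (i |: A))).
have FC i j : i \notin A -> j \notin A -> i != j -> F i j = - F j i.
  move=> iA jA ij; rewrite /F kos_signU2 // setUCA (mulrC (x i)) -scaleNr.
  by congr (_ *: _); case: (_ (+) _); rewrite //= ?expr1 ?expr0 ?opprK.
under eq_bigr => i iA.
  rewrite ffunE !scaler_sumr.
  under eq_bigr => j jA do
    rewrite !scalerA -(mulrA (_ * _)) mulrACA -signr_addb -scalerA -/(F i j).
  rewrite (bigID (fun j => (i < j)%N)) /=.
  over.
rewrite /= big_split /= !pair_big_dep /= [X in _ + X](reindex (fun p => (p.2, p.1))) /=.
  rewrite addrC -[X in _ + X]opprK -sumrN; apply/eqP; rewrite subr_eq0; apply/eqP.
  apply: eq_big => [[i j]|[i j]] /=; rewrite !inE -leqNgt.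
    have [->|ij] := eqVneq i j; first by rewrite ltnn ?eqxx /= ?andbF.
    rewrite ltn_neqAle -(inj_eq val_inj) in ij *; rewrite /= ij.
    by case: (i \in A); case: (j \in A).
  case/and3P=> jA; rewrite negb_or => /andP[ij iA] _.
  by rewrite FC // eq_sym.
by exists (fun p => (p.2, p.1)) => -[].
Qed.

Lemma kd_wedge (N : lmodType R) j (z : kos N) :
  kd (kos_wedge j z) + kos_wedge j (kd z) = x j *: z.
Proof.
apply/ffunP=> A; rewrite !ffunE; case: ifPn => jA; last first.
  rewrite addr0 (bigD1 j) //= ffunE setU11 setU1K // !scalerA mulrAC -signr_addb.
  rewrite addbb mul1r big1 ?addr0 // => i /andP[iA ij].
  by rewrite ffunE !inE eq_sym (negPf ij) (negPf jA) !scaler0.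
have [B jB ->] : exists2 B : {set 'I_m}, j \notin B & A = j |: B.
  by exists (A :\ j); rewrite ?setD11 ?setD1K.
rewrite setU1K // (bigD1 j (P := fun i => i \notin B)) //= scalerDr.
rewrite !scalerA -signr_addb addbb mul1r addrCA scaler_sumr.
rewrite [X in _ + (X + _)](eq_bigl (fun i => (i \notin B) && (i != j))); last first.
  by move=> i; rewrite !inE negb_or andbC.
rewrite -big_split big1 ?addr0 //= => i /andP[iB ij].
rewrite ffunE !inE eqxx orbT.
have -> : (i |: (j |: B)) :\ j = i |: B.
  by rewrite setUCA setU1K // !inE negb_or eq_sym ij.
rewrite !scalerA (mulrAC _ (x i)) -!signr_addb -scalerDl -mulrDl !kos_signU //.
have -> : (j < i)%N = ~~ (i < j)%N.
  by rewrite -leqNgt ltn_neqAle -(inj_eq val_inj) eq_sym in ij *; rewrite ij.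
by case: (_ < _)%N; case: (kos_sign B i); case: (kos_sign B j);
  rewrite /= ?expr1 ?expr0 ?addNr ?subrr mul0r scale0r.
Qed.

Lemma kos_wedge0 (N : lmodType R) j : kos_wedge j (0 : kos N) = 0.
Proof. by apply/ffunP=> A; rewrite !ffunE scaler0 if_same. Qed.

Definition kmap (N N' : lmodType R) (f : N -> N') (z : kos N) : kos N' :=
  [ffun A : {set 'I_m} => f (z A)].

Lemma kmap_linear (N N' : lmodType R) (f : {linear N -> N'}) : linear (kmap f).
Proof. by move=> a z w; apply/ffunP=> A; rewrite !ffunE linearP. Qed.
HB.instance Definition _ (N N' : lmodType R) (f : {linear N -> N'}) :=
  GRing.isLinear.Build R {ffun {set 'I_m} -> N} {ffun {set 'I_m} -> N'} _
    (kmap f) (kmap_linear f).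

Lemma kd_map (N N' : lmodType R) (f : {linear N -> N'}) (z : kos N) :
  kd (kmap f z) = kmap f (kd z).
Proof.
apply/ffunP=> A; rewrite !ffunE linear_sum; apply: eq_bigr => i _.
by rewrite ffunE !(linearZ_LR f).
Qed.

Lemma kmap_comp0 (N N' N'' : lmodType R) (f : N -> N') (g : N' -> N'')
  (z : kos N) : (forall u, g (f u) = 0) -> kmap g (kmap f z) = 0.
Proof. by move=> gf; apply/ffunP=> A; rewrite !ffunE gf. Qed.

Lemma kmap_surj (N N' : lmodType R) (f : N -> N') (z : kos N') :
  (forall A, exists u, f u = z A) -> exists w, kmap f w = z.
Proof.
move=> /choice[w wE]; exists [ffun A => w A].
by apply/ffunP=> A; rewrite !ffunE.
Qed.

Definition ktrunc (N : lmodType R) e (z : kos N) : kos N :=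
  [ffun A : {set 'I_m} => if #|A| == e then z A else 0].

Lemma ktrunc_linear (N : lmodType R) e : linear (@ktrunc N e).
Proof.
move=> a z w; apply/ffunP=> A; rewrite !ffunE; case: ifP => // _.
by rewrite scaler0 addr0.
Qed.
HB.instance Definition _ (N : lmodType R) e :=
  GRing.isLinear.Build R {ffun {set 'I_m} -> N} {ffun {set 'I_m} -> N} _
    (@ktrunc N e) (@ktrunc_linear N e).

Lemma kd_trunc (N : lmodType R) e (z : kos N) :
  kd (ktrunc e.+1 z) = ktrunc e (kd z).
Proof.
apply/ffunP=> A; rewrite !ffunE; case: ifP => Ae.
  by apply: eq_bigr => i iA; rewrite ffunE cardsU1 iA add1n eqSS Ae.
apply: big1 => i iA; rewrite ffunE cardsU1 iA add1n eqSS Ae.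
by rewrite !scaler0.
Qed.

Lemma kmap_trunc (N N' : lmodType R) (f : {linear N -> N'}) e (z : kos N) :
  kmap f (ktrunc e z) = ktrunc e (kmap f z).
Proof. by apply/ffunP=> A; rewrite !ffunE; case: ifP => // _; rewrite linear0. Qed.

Lemma ktruncK (N : lmodType R) e (z : kos N) : ktrunc e (ktrunc e z) = ktrunc e z.
Proof. by apply/ffunP=> A; rewrite !ffunE; case: ifP => // ->. Qed.

Definition khom (N : lmodType R) e (z : kos N) : Prop := ktrunc e z = z.

Lemma khom_lin (N : lmodType R) e a (z w : kos N) :
  khom e z -> khom e w -> khom e (a *: z + w).
Proof. by move=> zh wh; rewrite /khom linearP /= zh wh. Qed.

Lemma khom0 (N : lmodType R) e (z : kos N) A : khom e z -> #|A| != e -> z A = 0.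
Proof. by move=> <- /negPf Ae; rewrite ffunE Ae. Qed.

Lemma khom_map (N N' : lmodType R) (f : {linear N -> N'}) e (z : kos N) :
  khom e z -> khom e (kmap f z).
Proof. by move=> zh; rewrite /khom -kmap_trunc zh. Qed.

Lemma khom_trunc (N : lmodType R) e (z : kos N) : khom e (ktrunc e z).
Proof. exact: ktruncK. Qed.

Lemma kd_hom (N : lmodType R) e (z : kos N) : khom e.+1 z -> khom e (kd z).
Proof. by move=> zh; rewrite /khom -kd_trunc zh. Qed.

Definition kunit (N : lmodType R) B (v : N) : kos N :=
  [ffun A : {set 'I_m} => if A == B then v else 0].

Lemma khom_unit (N : lmodType R) B (v : N) : khom #|B| (kunit B v).
Proof.
apply/ffunP=> A; rewrite !ffunE.
by case: (eqVneq A B) => [->|]; rewrite ?eqxx ?if_same.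
Qed.

Lemma kd_hom0 (N : lmodType R) (z : kos N) : khom 0 z -> kd z = 0.
Proof.
move=> zh; apply/ffunP=> A; rewrite !ffunE big1 // => i iA.
by rewrite (khom0 zh) ?scaler0 // cardsU1 iA.
Qed.

End Differential.
End KoszulComplex.

(** * Projective resolutions *)

Section FreeModules.
Variable R : comNzRingType.

Lemma fglift_linear (T : choiceType) (M : lmodType R) (f : T -> M) :
  linear (fglift f).
Proof.
have fB := lift_is_additive f.
have f0 : fglift f 0 = 0 by rewrite -(subrr 0) fB subrr.
have fD u v : fglift f (u + v) = fglift f u + fglift f v.
  by rewrite -[v in LHS]opprK fB -[- v]add0r fB f0 add0r opprK.
move=> a u v; rewrite fD; congr (_ + _).
have fS (s : seq T) (F : T -> {freeg T / R}) :
    fglift f (\sum_(i <- s) F i) = \sum_(i <- s) fglift f (F i).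
  by elim: s => [|t s IHs]; rewrite !(big_nil, big_cons) ?fD ?IHs.
have -> : a *: u = fgscale a u by [].
rewrite -[u in RHS]freeg_sumE !fS scaler_sumr.
by apply: eq_bigr => t _; rewrite !liftU scalerA.
Qed.
HB.instance Definition _ (T : choiceType) (M : lmodType R) (f : T -> M) :=
  GRing.isLinear.Build R {freeg T / R} M _ (fglift f) (fglift_linear f).

Lemma fglift1 (T : choiceType) (M : lmodType R) (f : T -> M) t :
  fglift f << t >> = f t.
Proof. by rewrite liftU scale1r. Qed.

Lemma freeg_linear_ext (T : choiceType) (M : lmodType R)
    (f g : {linear {freeg T / R} -> M}) :
  (forall t, f << t >> = g << t >>) -> f =1 g.
Proof.
move=> fg u; rewrite -(freeg_sumE u) !linear_sum; apply: eq_bigr => t _.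
have -> : << coeff t u *g t >> = coeff t u *: << t >> :> {freeg T / R}.
  apply/eqP/freeg_eqP => t'; rewrite coeffZ !coeffU mul1r.
  by [].
by rewrite !linearZ_LR fg.
Qed.

Lemma freeg_lift (T : choiceType) (A B : lmodType R) (g : {linear A -> B})
    (f : {linear {freeg T / R} -> B}) :
    (forall u, exists a, g a = f u) ->
  exists h : {linear {freeg T / R} -> A}, forall u, g (h u) = f u.
Proof.
move=> gf; have [h0 h0E] := boolp.choice (fun t => gf << t >>).
exists (fglift h0); apply: (freeg_linear_ext (f := g \o fglift h0)) => t.
by rewrite /= fglift1.
Qed.

Lemma freeg_projective (T : choiceType) : projective ({freeg T / R} : lmodType R).
Proof. by move=> A B g f gsurj; apply: freeg_lift => u; apply: gsurj. Qed.

Lemma projective_retract (P : lmodType R) : projective P ->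
  exists s : {linear P -> {freeg P / R}}, forall u, fglift id (s u) = u.
Proof.
move=> /(_ {freeg P / R} P (fglift id) idfun)[].
  by move=> b; exists << b >>; apply: fglift1.
by move=> s sE; exists s.
Qed.

Lemma projective_lift (P A B : lmodType R) (g : {linear A -> B})
    (f : {linear P -> B}) : projective P -> (forall u, exists a, g a = f u) ->
  exists h : {linear P -> A}, forall u, g (h u) = f u.
Proof.
move=> /projective_retract[s sE] gf.
have [h hE] := freeg_lift (f := f \o fglift id) (fun u => gf (fglift id u)).
by exists (h \o s) => u /=; rewrite hE /= sE.
Qed.

Lemma linear_factor (A B C : lmodType R) (g : {linear A -> B})
    (f : {linear A -> C}) : (forall b, exists a, g a = b) ->
    (forall a, g a = 0 -> f a = 0) ->
  exists h : {linear B -> C}, forall a, h (g a) = f a.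
Proof.
move=> /boolp.choice[s sE] gf.
have hE a : f (s (g a)) = f a.
  by apply/eqP; rewrite -subr_eq0 -linearB gf // linearB /= sE subrr.
have hl : linear (f \o s).
  move=> a u v /=; rewrite -linearP -[RHS]hE; congr (f (s _)).
  by rewrite linearP !sE.
pose hL := GRing.isLinear.Build R B C _ _ hl.
pose h : {linear B -> C} := HB.pack (f \o s) hL.
by exists h.
Qed.

Record linear_arrow := LinearArrow {
  arr_src : lmodType R; arr_tgt : lmodType R; arr_map : {linear arr_src -> arr_tgt}
}.

Definition kernel_cover (f : linear_arrow) : linear_arrow :=
  @LinearArrow {freeg {u : arr_src f | arr_map f u == 0} / R} (arr_src f)
    (fglift val).

Lemma kernel_coverP (f : linear_arrow) u :
  arr_map f u = 0 <-> exists v, arr_map (kernel_cover f) v = u.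
Proof.
split=> [fu|[v <-]].
  have fuP : arr_map f u == 0 by apply/eqP.
  by exists << exist _ u fuP >>; rewrite /= fglift1.
apply: (freeg_linear_ext (f := arr_map f \o fglift val) (g := \0)) => t /=.
by rewrite fglift1; apply/eqP; apply: (valP t).
Qed.

Fixpoint free_resolution_arrow (M : lmodType R) n : linear_arrow :=
  if n is n'.+1 then kernel_cover (free_resolution_arrow M n')
  else @LinearArrow {freeg M / R} M (fglift id).

Lemma free_resolution (M : lmodType R) : proj_resolution M.
Proof.
pose a := free_resolution_arrow M.
refine (@ProjResolution R M (fun n => arr_src (a n)) (fun n => arr_map (a n.+1))
  (arr_map (a 0)) _ _ _ _).
- by case=> [|n]; apply: freeg_projective.
- by move=> n u; exact: (kernel_coverP (f := a n.+1) u).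
- by move=> u; exact: (kernel_coverP (f := a 0) u).
- by move=> z; exists << z >>; rewrite /= fglift1.
Qed.

Lemma chain_lift_exists (M N : lmodType R) (P : proj_resolution M)
    (Q : proj_resolution N) (phi : {linear P 0 -> N}) : cocycle phi ->
  exists f : forall i, {linear P i -> Q i},
    (forall u, res_aug Q (f 0 u) = phi u) /\
    (forall i u, res_diff Q i (f i.+1 u) = f i (res_diff P i u)).
Proof.
move=> phi0.
have [f0 f0E] : exists f0 : {linear P 0 -> Q 0},
    forall u, res_aug Q (f0 u) = phi u.
  by apply: projective_lift => [|u]; [apply: res_proj|apply: res_surj].
have [f1 f1E] : exists f1 : {linear P 1 -> Q 1},
    forall u, res_diff Q 0 (f1 u) = f0 (res_diff P 0 u).
  apply: (projective_lift (f := f0 \o res_diff P 0)); first exact: res_proj.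
  by move=> u /=; apply/res_exact0; rewrite f0E.
pose square n := {h : {linear P n -> Q n} * {linear P n.+1 -> Q n.+1} |
  forall u, res_diff Q n (h.2 u) = h.1 (res_diff P n u)}.
have next n (s : square n) : {s' : square n.+1 | (sval s').1 = (sval s).2}.
  case: s => -[h h'] hh' /=; apply: cid.
  have [h'' h''E] : exists h'' : {linear P n.+2 -> Q n.+2},
      forall u, res_diff Q n.+1 (h'' u) = h' (res_diff P n.+1 u).
    apply: (projective_lift (f := h' \o res_diff P n.+1)); first exact: res_proj.
    move=> u /=; apply/res_exact; rewrite hh' /=.
    have -> : res_diff P n (res_diff P n.+1 u) = 0 by apply/res_exact; exists u.
    exact: linear0.
  by exists (exist _ (h', h'') h''E).
pose s := nat_rect square (exist _ (f0, f1) f1E) (fun n s => sval (next n s)).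
exists (fun n => (sval (s n)).1); split=> // n u.
by rewrite [s n.+1]/= (svalP (next n (s n))) (svalP (s n)).
Qed.

End FreeModules.

(** * Multidegrees and exactness of the Koszul complex *)

Section Multidegrees.
Variables (k : fieldType) (m : nat).
Local Notation S := {mpoly k[m]}.
Local Notation kos N := {ffun {set 'I_m} -> N}.
Local Notation chain := {ffun {set 'I_m} -> k^o}.
Implicit Types (A B U : {set 'I_m}) (b : 'X_{1..m}) (c : chain).

Lemma boundaryE c : boundary c = kd (fun=> 1) c.
Proof.
apply/ffunP=> A; rewrite /boundary sum_ffunE ffunE.
under eq_bigr => s _ do rewrite ffunE sum_ffunE scaler_sumr.
rewrite (exchange_big_dep xpredT) //= [in RHS]big_mkcond.
apply: eq_bigr => i _; case: ifP => iA.
  rewrite (bigD1 (i |: A)) ?setU11 //= big1 ?addr0.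
    rewrite setU1K // !ffunE eqxx scale1r.
    rewrite -[LHS]/(_ * (_ * 1)) mulr1 mulrC -signr_odd.
    congr ((-1) ^+ odd #|pred_of_set _| * _); apply/setP=> j; rewrite !inE.
    by case: (eqVneq j i) => [->|_]; rewrite ?ltnn ?andbF.
  move=> s /andP[si sA]; rewrite !ffunE; case: eqVneq => [As|_].
    by rewrite As setD1K ?eqxx in sA.
  by rewrite !scaler0.
apply: big1 => s si; rewrite !ffunE; case: eqVneq => [As|_].
  by rewrite As setD11 in iA.
by rewrite !scaler0.
Qed.

Definition vars : 'I_m -> S := fun i => 'X_i.

Definition smon A : 'X_{1..m} := [multinom (i \in A : nat) | i < m].

Lemma smonU1 A i : i \notin A -> smon (i |: A) = (U_(i) + smon A)%MM.
Proof.
move=> iA; apply/mnmP=> j; rewrite !mnmE !inE (eq_sym j i).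
by case: eqVneq => // <-; rewrite (negPf iA).
Qed.

Lemma prod_smon A : \prod_(i in A) 'X_i = 'X_[smon A] :> S.
Proof.
rewrite mpolyXE_id big_mkcond; apply: eq_bigr => i _.
by rewrite mnmE; case: (i \in A); rewrite ?expr1 ?expr0.
Qed.

(* The component of multidegree b of a Koszul chain over S: there the Koszul  *)
(* differential becomes the simplicial boundary.                              *)
Definition kcoef b (z : kos S^o) : chain :=
  [ffun A : {set 'I_m} => (z A * 'X_[smon A])@_b].

Lemma kcoefD b A (z : kos S^o) : kcoef (b + smon A)%MM z A = (z A)@_b.
Proof. by rewrite ffunE addmC mcoeffMX. Qed.

Lemma kcoef_neq0 b A (z : kos S^o) : kcoef b z A != 0 -> (smon A <= b)%MM.
Proof.
rewrite ffunE -mcoeff_msupp (perm_mem (msuppMX _ _)) => /mapP[b' _ ->].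
exact: lem_addr.
Qed.

Lemma kcoef_inj (z w : kos S^o) : (forall b, kcoef b z = kcoef b w) -> z = w.
Proof.
by move=> zw; apply/ffunP=> A; apply/mpolyP=> b; rewrite -!kcoefD zw.
Qed.

Lemma kcoef_kd b (z : kos S^o) : kcoef b (kd vars z) = kd (fun=> 1) (kcoef b z).
Proof.
apply/ffunP=> A; rewrite !ffunE mulr_suml raddf_sum; apply: eq_bigr => i iA.
rewrite ffunE smonU1 // mpolyXD scale1r.
have -> : (-1) ^+ kos_sign A i *: (vars i *: z (i |: A)) * 'X_[smon A]
   = ((-1) ^+ kos_sign A i : k) *: (z (i |: A) * ('X_i * 'X_[smon A])) :> S.
  have -> : vars i *: z (i |: A) = z (i |: A) * 'X_i by rewrite mulrC.
  case: (kos_sign A i); rewrite ?expr1 ?expr0 ?scaleN1r ?scale1r ?mulNr mulrA //.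
exact: mcoeffZ.
Qed.

Lemma kos_of_components (z : kos S^o) (c : 'X_{1..m} -> chain) :
    (forall b, kd (fun=> 1) (c b) = kcoef b z) ->
    (forall b A, c b A != 0 -> (smon A <= b)%MM) ->
  exists2 y : kos S^o, kd vars y = z &
    forall A b, (y A)@_b != 0 -> c (b + smon A)%MM A != 0.
Proof.
move=> cz cle.
pose N := (\max_A msize (z A * 'X_[smon A]))%N.
pose y : kos S^o := [ffun A =>
  \sum_(b : 'X_{1..m < N}) c b A *: 'X_[((b : 'X_{1..m}) - smon A)%MM] ].
have yE b : kcoef b y = if (mdeg b < N)%N then c b else 0.
  apply/ffunP=> A; rewrite !ffunE mulr_suml raddf_sum /=.
  have E (b' : 'X_{1..m < N}) :
      (c b' A *: 'X_[((b' : 'X_{1..m}) - smon A)%MM] * 'X_[smon A])@_b =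
      if b == b' then c b' A else 0.
    rewrite -scalerAl mcoeffZ -mpolyXD mcoeffX.
    have [->|/cle/submK->] := eqVneq (c b' A) 0; first by rewrite mul0r if_same.
    by rewrite eq_sym; case: eqP; rewrite ?mulr1 ?mulr0.
  under eq_bigr => b' _ do rewrite E.
  rewrite -big_mkcond; case: ifP => bN; last first.
    by rewrite big1 ?ffunE // => b' /eqP bb'; rewrite bb' bmdeg in bN.
  by rewrite (big_pred1 (BMultinom bN)) // => b'; rewrite -val_eqE eq_sym.
exists y.
  apply: kcoef_inj => b; rewrite kcoef_kd yE -cz; case: ifP => // /negbT.
  rewrite -leqNgt linear0 => Nb; rewrite cz; apply/ffunP=> A; rewrite !ffunE.
  apply/esym/memN_msupp_eq0/msize_mdeg_ge; apply: leq_trans Nb.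
  exact: (leq_bigmax (F := fun A => msize (z A * 'X_[smon A]))).
move=> A b; rewrite -kcoefD yE; case: ifP => // _.
by rewrite ffunE eqxx.
Qed.

Lemma kd_exact_poly e (z : kos S^o) : khom e.+1 z -> kd vars z = 0 ->
  exists y, kd vars y = z.
Proof.
move=> zh zc.
pose c b : chain := if [pick j | b j != 0%N] is Some j
  then kos_wedge j (kcoef b z) else 0.
have [||y yz _] := @kos_of_components z c; last by exists y.
  move=> b; rewrite /c; case: pickP => [j bj|b0].
    have := kd_wedge (fun=> 1 : k) j (kcoef b z).
    have k0 : kcoef b 0 = 0 by apply/ffunP=> A; rewrite !ffunE mul0r mcoeff0.
    by rewrite -kcoef_kd zc k0 scale1r kos_wedge0 addr0.
  have {}b0 : b = 0%MM by apply/mnmP=> i; rewrite mnm0E; apply/eqP/negbFE/b0.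
  rewrite linear0; apply/esym/ffunP=> A; rewrite [RHS]ffunE; apply/eqP.
  have [->|A0] := eqVneq A set0; first
    by rewrite ffunE (khom0 zh) ?mul0r ?mcoeff0 ?eqxx ?cards0.
  have /set0Pn[i iA] := A0; apply: contraT => /kcoef_neq0.
  by move=> /mnm_lepP/(_ i); rewrite b0 mnm0E mnmE iA.
move=> b A; rewrite /c; case: pickP => [j bj|_]; rewrite ffunE ?eqxx //.
case: ifP => [jA|_]; last by rewrite eqxx.
rewrite scaler_eq0 negb_or => /andP[_ /kcoef_neq0/mnm_lepP Ab].
apply/mnm_lepP=> i; move: (Ab i); rewrite !mnmE !inE.
by case: (eqVneq i j) => [->|//]; rewrite jA lt0n bj.
Qed.

Lemma kd_exact_free (T : choiceType) e (z : kos {freeg T / S}) :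
  khom e.+1 z -> kd vars z = 0 -> exists y, kd vars y = z.
Proof.
move=> zh zc.
pose co t : {linear {freeg T / S} -> S^o} := fglift (fun u => (u == t)%:R).
have /boolp.choice[y yE] t : exists y, kd vars y = kmap (co t) z.
  by apply: (@kd_exact_poly e); rewrite ?kd_map ?zc ?linear0 //; apply: khom_map.
pose D := undup (flatten [seq dom (z A) | A : {set 'I_m}]).
have injl t : linear (fun a : S^o => a *: << t >> : {freeg T / S}).
  by move=> a u v; rewrite scalerDl -scalerA.
pose inj t : {linear S^o -> {freeg T / S}} :=
  HB.pack (fun a : S^o => a *: << t >> : {freeg T / S})
    (GRing.isLinear.Build S S^o {freeg T / S} _ _ (injl t)).
exists (\sum_(t <- D) kmap (inj t) (y t)).
have E t : kd vars (kmap (inj t) (y t)) = kmap (inj t) (kmap (co t) z).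
  by rewrite -yE; apply: kd_map.
rewrite linear_sum (eq_bigr _ (fun t _ => E t)).
apply/ffunP=> A; rewrite sum_ffunE; under eq_bigr => t _ do rewrite !ffunE.
apply/eqP/freeg_eqP => t; rewrite raddf_sum.
transitivity (\sum_(i <- D) coeff i (z A) * (i == t)%:R).
  apply: eq_bigr => i _.
  by rewrite -[LHS]/(coeff t (coeff i (z A) *: << i >>)) coeffZ coeffU mul1r.
have [tD|tD] := boolP (t \in D).
  rewrite (bigD1_seq t) ?undup_uniq //= eqxx mulr1 big1 ?addr0 // => i /negPf->.
  by rewrite mulr0.
rewrite big1_seq => [|i /andP[_ iD]]; last first.
  by case: eqVneq iD tD => [->->|]; rewrite ?mulr0.
apply/esym/coeff_outdom; apply: contra tD => tA; rewrite mem_undup.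
by apply/flattenP; exists (dom (z A)) => //; apply: image_f.
Qed.

Lemma kd_exact (P : lmodType S) e (z : kos P) : projective P ->
  khom e.+1 z -> kd vars z = 0 -> exists y, kd vars y = z.
Proof.
move=> /projective_retract[s sE] zh zc.
have [||y yz] := @kd_exact_free P e (kmap s z).
- exact: khom_map.
- by rewrite kd_map zc linear0.
exists (kmap (fglift id) y); rewrite kd_map yz.
by apply/ffunP=> A; rewrite !ffunE; apply: sE.
Qed.

End Multidegrees.

(** * Functionals with values in the residue field *)

Section ResidueExtension.
Variables (k : fieldType) (m : nat).
Local Notation S := {mpoly k[m]}.
Local Notation kk := (residue_field k : lmodType S).
Local Notation ev p := (meval (fun=> 0) p).

Lemma residue_scaleE (p : S) (a : kk) : p *: a = ev p * (a : k) :> k.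
Proof. by []. Qed.

Definition maxideal_mul (V : lmodType S) (u : V) : Prop :=
  exists y : 'I_m -> V, u = \sum_i vars k i *: y i.

Section Module.
Variable V : lmodType S.
Implicit Types (u v : V) (s : S).

Lemma maxideal_mul_lin s u v :
  maxideal_mul u -> maxideal_mul v -> maxideal_mul (s *: u + v).
Proof.
move=> [y ->] [w ->]; exists (fun i => s *: y i + w i).
rewrite scaler_sumr -big_split; apply: eq_bigr => i _.
by rewrite scalerDr !scalerA mulrC.
Qed.

Lemma maxideal_mul0 : maxideal_mul (0 : V).
Proof. by exists (fun=> 0); rewrite big1 // => i _; rewrite scaler0. Qed.

Lemma maxideal_mulX i u : maxideal_mul (vars k i *: u).
Proof.
exists (fun j => if j == i then u else 0); rewrite (bigD1 i) //= eqxx big1 ?addr0 //.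
by move=> j /negPf->; rewrite scaler0.
Qed.

Lemma maxideal_mulZ s u : ev s = 0 -> maxideal_mul (s *: u).
Proof.
have H : maxideal_mul ((s - (ev s)%:MP) *: u).
  elim/mpolyind: s => [|c b p _ _ IHp].
    rewrite meval0 mpolyC0 subrr scale0r; exact: maxideal_mul0.
  rewrite mevalD mevalZ mpolyCD opprD addrACA scalerDl -[X in X *: u]mul1r -scalerA.
  apply: maxideal_mul_lin IHp.
  have [->|b0] := eqVneq b 0%MM.
    rewrite mpolyX0 meval1 mulr1 -mul_mpolyC mulr1 subrr scale0r.
    exact: maxideal_mul0.
  have /existsP[i bi] : [exists i, b i != 0%N].
    rewrite -negb_forall; apply: contra b0 => /forallP b0.
    by apply/eqP/mnmP=> i; rewrite mnm0E; apply/eqP.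
  have -> : ev ('X_[b] : S) = 0.
    by rewrite mevalX (bigD1 i) //= expr0n (negPf bi) mul0r.
  rewrite mulr0 mpolyC0 subr0 -[b](@submK _ U_(i)%MM); last first.
    by apply/mnm_lepP=> j; rewrite mnm1E; case: eqVneq => // <-; rewrite lt0n.
  rewrite mpolyXD -mul_mpolyC mulrA mulrC -scalerA; exact: maxideal_mulX.
by move=> s0; rewrite s0 mpolyC0 subr0 in H.
Qed.

Lemma maxideal_mul_residue (f : {linear V -> kk}) u : maxideal_mul u -> f u = 0.
Proof.
case=> y ->; rewrite linear_sum big1 // => i _; rewrite linearZ_LR.
by rewrite residue_scaleE mevalXU mul0r.
Qed.

Definition residue_relation (H : V * k -> Prop) : Prop :=
  forall s p q, H p -> H q -> H (s *: p.1 + q.1, ev s * p.2 + q.2).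

(* Zorn's lemma extends the functional k-linearly to V; it is made to vanish  *)
(* on m V from the start, which makes the extension S-linear.                 *)
Lemma residue_extension (G : V * k -> Prop) :
    G (0, 0) -> residue_relation G ->
    (forall u a, maxideal_mul u -> G (u, a) -> a = 0) ->
  exists f : {linear V -> kk}, forall u a, G (u, a) -> f u = a.
Proof.
move=> G0 Glin Gm.
pose G1 p := exists q y, [/\ G q, maxideal_mul y & p = (q.1 + y, q.2)].
pose good (H : V * k -> Prop) := residue_relation H /\ forall a, H (0, a) -> a = 0.
pose ext (A : V * k -> Prop) p := G1 p \/ A p.
have G1lin : residue_relation G1.
  move=> s _ _ [p [y [Gp my ->]]] [q [w [Gq mw ->]]] /=.
  exists (s *: p.1 + q.1, ev s * p.2 + q.2), (s *: y + w).
  by split; [apply: Glin|apply: maxideal_mul_lin|rewrite scalerDr addrACA].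
have G1fun a : G1 (0, a) -> a = 0.
  case=> -[u b] [y [Gq my [/esym/eqP uy ->]]] /=; apply: Gm Gq.
  move: uy; rewrite addr_eq0 => /eqP->; rewrite -[- y]addr0 -scaleN1r.
  exact: maxideal_mul_lin my maxideal_mul0.
have G1m s v : ev s = 0 -> G1 (s *: v, 0).
  by move=> s0; exists (0, 0), (s *: v); split; rewrite ?add0r //; apply: maxideal_mulZ.
have [|A [[Hlin Hfun] Amax]] := @classical_sets.Zorn_bigcup _ (fun A => good (ext A)).
  move=> F FP Ftot; split=> [s p q|a].
    case=> [pG|[A FA Ap]] [qG|[B FB Bq]]; first by left; apply: G1lin.
    - have [Hl _] := FP _ FB.
      by have [|] := Hl s p q (or_introl pG) (or_intror Bq); [left|right; exists B].
    - have [Hl _] := FP _ FA.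
      by have [|] := Hl s p q (or_intror Ap) (or_introl qG); [left|right; exists A].
    have [AB|BA] := Ftot _ _ FA FB.
      have [Hl _] := FP _ FB.
      by have [|] := Hl s p q (or_intror (AB _ Ap)) (or_intror Bq); [left|right; exists B].
    have [Hl _] := FP _ FA.
    by have [|] := Hl s p q (or_intror Ap) (or_intror (BA _ Bq)); [left|right; exists A].
  case=> [/G1fun//|[A FA Aa]].
  by have [_ Hf] := FP _ FA; apply: Hf; right.
pose H := ext A.
have H0 : H (0, 0).
  by left; have := @G1m 0 0; rewrite meval0 scale0r; apply.
have Htot v : exists a, H (v, a).
  apply: contrapT => /forallNP nv.
  pose A' p := exists s q, H q /\ p = (s *: v + q.1, q.2).
  have HA' p : H p -> A' p.
    by case: p => u a Hp; exists 0, (u, a); rewrite scale0r add0r.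
  apply: (Amax A').
    split=> [p Ap|A'A]; first by apply: HA'; right.
    apply: (nv 0); right; apply: A'A; exists 1, (0, 0).
    by rewrite scale1r addr0.
  split=> [s p q A'p A'q|a A'a].
    right; have {A'p} [t [p' [Hp' ->]]] : A' p by case: A'p => // ?; apply: HA'; left.
    have {A'q} [t' [q' [Hq' ->]]] : A' q by case: A'q => // ?; apply: HA'; left.
    exists (s * t + t'), (s *: p'.1 + q'.1, ev s * p'.2 + q'.2).
    by split; [apply: Hlin|rewrite /= scalerDr scalerA addrACA scalerDl].
  have {A'a} [s [[u b] [Hu [/esym/eqP uE ->]]]] : A' (0, a).
    by case: A'a => // ?; apply: HA'; left.
  have [s0|s0] := eqVneq (ev s) 0.
    apply: Hfun; rewrite -(eqP uE); have := Hlin 1 _ _ (or_introl (G1m s v s0)) Hu.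
    by rewrite meval1 mul1r scale1r add0r.
  case: (nv (- (ev s)^-1 * b)).
  have := Hlin (- (ev s)^-1)%:MP _ _ Hu
    (or_introl (G1m (1 - (ev s)^-1%:MP * s) v _)).
  rewrite mevalB meval1 mevalM !mevalC mulVf // subrr addr0; move=> /(_ erefl).
  move: uE; rewrite addrC addr_eq0 => /eqP /= ->.
  by rewrite scalerN mpolyCN scaleNr opprK scalerA -scalerDl addrC subrK scale1r.
have [f fH] := boolp.choice Htot.
have Huniq u a b : H (u, a) -> H (u, b) -> a = b.
  move=> Ha Hb; apply/eqP; rewrite -subr_eq0; apply/eqP/Hfun.
  have := Hlin (-1) _ _ Hb Ha; rewrite mevalN meval1 mulN1r /=.
  by rewrite [- b + a]addrC scaleN1r addNr.
have fl : linear (f : V -> kk).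
  move=> s u v; apply: (Huniq (s *: u + v)); first exact: fH.
  exact: Hlin (fH u) (fH v).
pose g : {linear V -> kk} := HB.pack (f : V -> kk)
  (GRing.isLinear.Build S V kk _ _ fl).
exists g => u a Gu; apply: (Huniq u) => //.
left; exists (u, a), 0; split=> //; last by rewrite addr0.
exact: maxideal_mul0.
Qed.

End Module.
End ResidueExtension.

(** * Zigzags and the pairing of Ext with Koszul homology *)

Section Zigzags.
Variables (k : fieldType) (m : nat).
Local Notation S := {mpoly k[m]}.
Local Notation kk := (residue_field k : lmodType S).
Local Notation ev p := (meval (fun=> 0) p).
Local Notation kos N := {ffun {set 'I_m} -> N}.
Local Notation kdX := (kd (@vars k m)).
Implicit Types (A B : {set 'I_m}).

Lemma kd_maxideal (N : lmodType S) (z : kos N) A : maxideal_mul (kdX z A).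
Proof.
exists (fun i => if i \in A then 0 else (-1) ^+ kos_sign A i *: z (i |: A)).
rewrite ffunE big_mkcond; apply: eq_bigr => i _.
by case: (i \in A); rewrite /= ?scaler0 // !scalerA mulrC.
Qed.

Lemma kunit0 (N : lmodType S) (z : kos N) : khom 0 z -> z = kunit set0 (z set0).
Proof.
move=> zh; apply/ffunP=> A; rewrite ffunE; case: eqVneq => [->//|A0].
by apply: (khom0 zh); rewrite cards_eq0.
Qed.

Lemma kmap_unit (N N' : lmodType S) (f : {linear N -> N'}) B v :
  kmap f (kunit B v) = kunit B (f v) :> kos N'.
Proof. by apply/ffunP=> A; rewrite !ffunE; case: ifP => // _; rewrite linear0. Qed.

Lemma maxideal_kd (N : lmodType S) (v : N) : maxideal_mul v ->
  exists y : kos N, kdX y = kunit set0 v.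
Proof.
case=> y ->; pose w : kos N := \sum_i kunit [set i] (y i).
have wh : khom 1 w.
  rewrite /khom linear_sum; apply: eq_bigr => i _.
  by have := khom_unit [set i] (y i); rewrite cards1.
exists w; rewrite (kunit0 (kd_hom _ wh)) ffunE; congr (kunit _ _).
apply: eq_big => i; first by rewrite inE.
move=> _; rewrite setU0 /kos_sign (_ : [set _ in _ | _] = set0) ?cards0 ?scale1r.
  congr (_ *: _); rewrite sum_ffunE (bigD1 i) //= ffunE eqxx big1 ?addr0 // => j ji.
  by rewrite ffunE (inj_eq set1_inj) eq_sym (negPf ji).
by apply/setP=> j; rewrite !inE.
Qed.

Lemma cycle_maxideal (N : lmodType S) (z : kos N) (s : S) :
  kdX z = 0 -> ev s = 0 -> exists y, kdX y = s *: z.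
Proof.
move=> zc s0.
have [c ->] : exists c : 'I_m -> S, s = \sum_i vars k i * c i.
  by have [c sE] := maxideal_mulZ (1 : S^o) s0; exists c; rewrite -[LHS]mulr1.
exists (\sum_i kos_wedge i (c i *: z)); rewrite linear_sum scaler_suml.
apply: eq_bigr => i _ /=; have := kd_wedge (@vars k m) i (c i *: z).
by rewrite kdZ zc scaler0 kos_wedge0 addr0 scalerA.
Qed.

Lemma kd_residue (z : kos kk) : kdX z = 0.
Proof.
apply/ffunP=> A; rewrite !ffunE big1 // => i _.
by rewrite residue_scaleE residue_scaleE mevalXU mul0r mulr0.
Qed.

Section Resolution.
Variables (M : lmodType S) (P : proj_resolution M).

(* z over M is connected to w over P_n by chains w_i over P_i with w_0 lifting z  *)
(* and kd w_i the image of w_(i+1); here e is the exterior degree of w.          *)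
Fixpoint zigzag (z : kos M) n : nat -> kos (P n) -> Prop :=
  match n with
  | 0 => fun e w => khom e w /\ kmap (res_aug P) w = z
  | n'.+1 => fun e w => khom e w /\
      exists2 w0, zigzag z e.+1 w0 & kdX w0 = kmap (res_diff P n') w
  end.

Lemma zigzag_hom z n e w : @zigzag z n e w -> khom e w.
Proof. by case: n w => [|n] w []. Qed.

Lemma zigzag_lin z z' n e w w' s : @zigzag z n e w -> @zigzag z' n e w' ->
  zigzag (s *: z + z') e (s *: w + w').
Proof.
elim: n e w w' => [|n IHn] e w w' /= [wh wz] [wh' wz']; split; try exact: khom_lin.
  by rewrite linearP /= wz wz'.
have [w0 w0z w0w] := wz; have [w0' w0z' w0w'] := wz'.
by exists (s *: w0 + w0'); [apply: IHn|rewrite !linearP /= w0w w0w'].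
Qed.

Lemma zigzag0 n e : @zigzag 0 n e 0.
Proof.
elim: n e => [|n IHn] e /=; first by rewrite /khom !linear0.
by rewrite /khom linear0; split=> //; exists 0; rewrite ?linear0.
Qed.

Lemma res_diff_comp0 n (w : kos (P n.+2)) :
  kmap (res_diff P n) (kmap (res_diff P n.+1) w) = 0.
Proof. by apply: kmap_comp0 => u; apply/res_exact; exists u. Qed.

Lemma res_aug_comp0 (w : kos (P 1)) : kmap (res_aug P) (kmap (res_diff P 0) w) = 0.
Proof. by apply: kmap_comp0 => u; apply/res_exact0; exists u. Qed.

Lemma kmap_eq0 (N N' : lmodType S) (f : N -> N') (z : kos N) :
  kmap f z = 0 -> forall A, f (z A) = 0.
Proof. by move=> fz A; have /ffunP/(_ A) := fz; rewrite !ffunE. Qed.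

Lemma res_lift n (w : kos (P n.+1)) : kmap (res_diff P n) w = 0 ->
  exists v, kmap (res_diff P n.+1) v = w.
Proof. by move=> /kmap_eq0 w0; apply: kmap_surj => A; apply/res_exact. Qed.

Lemma res_lift0 (w : kos (P 0)) : kmap (res_aug P) w = 0 ->
  exists v, kmap (res_diff P 0) v = w.
Proof. by move=> /kmap_eq0 w0; apply: kmap_surj => A; apply/res_exact0. Qed.

Lemma zigzag_lift z n e w : kdX z = 0 -> @zigzag z n e w ->
  exists v, kmap (res_diff P n) v = kdX w.
Proof.
move=> zc; case: n w => [|n] w /= [_ wz].
  by apply: res_lift0; rewrite -kd_map wz.
have [w0 _ w0w] := wz.
by apply: res_lift; rewrite -kd_map -w0w kd_kd.
Qed.

Lemma zigzag_exists z n e : kdX z = 0 -> khom (n + e)%N z -> exists w, @zigzag z n e w.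
Proof.
move=> zc; elim: n e => [|n IHn] e zh.
  have [|w wz] := @kmap_surj m S _ _ (res_aug P) z; first by move=> A; apply: res_surj.
  by exists (ktrunc e w); split; rewrite ?kmap_trunc ?wz //; apply: khom_trunc.
have [|w wz] := IHn e.+1; first by rewrite addnS.
have [v vw] := zigzag_lift zc wz.
exists (ktrunc e v); split; first exact: khom_trunc.
by exists w => //; rewrite kmap_trunc vw -kd_trunc (zigzag_hom wz).
Qed.

Lemma zigzag_boundary y n e w : @zigzag (kdX y) n e w ->
  exists u v, w = kdX u + kmap (res_diff P n) v.
Proof.
elim: n e w => [|n IHn] e w /= [_ wz].
  have [|u uy] := @kmap_surj m S _ _ (res_aug P) y; first by move=> A; apply: res_surj.
  have [|v vE] := @res_lift0 (w - kdX u); first by rewrite linearB /= -kd_map uy wz subrr.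
  by exists u, v; rewrite vE addrC subrK.
have [w0 /IHn[u [v w0E]] w0w] := wz.
have [|v' v'E] := @res_lift n (w - kdX v).
  by rewrite linearB /= -w0w -kd_map w0E linearD /= kd_kd add0r subrr.
by exists v, v'; rewrite v'E addrC subrK.
Qed.

Lemma zigzag_boundary_conv z n e w u v : @zigzag z n e w ->
  w = kdX u + kmap (res_diff P n) v -> exists y, kdX y = z.
Proof.
elim: n e w u v => [|n IHn] e w u v /= [wh wz] wE.
  exists (kmap (res_aug P) u).
  by rewrite kd_map -wz wE linearD /= res_aug_comp0 addr0.
have [w0 w0z w0w] := wz.
have E : kmap (res_diff P n) w = kmap (res_diff P n) (ktrunc e (kdX u)).
  have <- : ktrunc e w = w := wh.
  rewrite wE !linearD /= kmap_trunc [X in _ + X]kmap_trunc res_diff_comp0.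
  by rewrite linear0 addr0.
have [|||u' u'E] := @kd_exact k m (P n) e (w0 - kmap (res_diff P n) (ktrunc e.+1 u)).
- exact: res_proj.
- rewrite addrC -scaleN1r; apply: khom_lin (zigzag_hom w0z).
  by apply: khom_map; apply: khom_trunc.
- by rewrite linearB /= w0w E kd_map kd_trunc subrr.
by apply: (IHn e.+1 w0 u' (ktrunc e.+1 u)) => //; rewrite u'E subrK.
Qed.

(* The condition for w to be the end of a zigzag that starts at a cycle.         *)
Definition liftable n : kos (P n) -> Prop :=
  match n with
  | 0 => fun w => kdX (kmap (res_aug P) w) = 0
  | n'.+1 => fun w => exists w0, kdX w0 = kmap (res_diff P n') w
  end.

Lemma zigzag_rev n e (w : kos (P n)) : khom e w -> liftable w ->
  exists z, [/\ khom (n + e)%N z, kdX z = 0 & zigzag z e w].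
Proof.
elim: n e w => [|n IHn] e w wh /= wl.
  by exists (kmap (res_aug P) w); split=> //; apply: khom_map.
have [w0 w0w] := wl.
have w0w' : kdX (ktrunc e.+1 w0) = kmap (res_diff P n) w.
  by rewrite kd_trunc w0w -kmap_trunc wh.
have [||z [zh zc w0z]] := IHn e.+1 (ktrunc e.+1 w0); first exact: khom_trunc.
  case: n w w0 wh w0w {IHn wl} w0w' => [|n] w w0 wh w0w w0w' /=.
    by rewrite kd_map w0w' res_aug_comp0.
  have [|||u uE] := @kd_exact k m (P n) e (kmap (res_diff P n) (ktrunc e.+1 w0)).
  - exact: res_proj.
  - by apply: khom_map; apply: khom_trunc.
  - by rewrite kd_map w0w' res_diff_comp0.
  by exists u.
exists z; split=> //; first by rewrite addSnnS.
by split=> //; exists (ktrunc e.+1 w0).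
Qed.

Lemma zigzag_end z n w : @zigzag z n 0 w -> w = kunit set0 (w set0).
Proof. by move=> /zigzag_hom/kunit0. Qed.

Lemma cocycle_boundary n (gamma : {linear P n -> kk}) y w :
  cocycle gamma -> @zigzag (kdX y) n 0 w -> gamma (w set0) = 0.
Proof.
move=> g0 /zigzag_boundary[u [v ->]].
have -> : (kdX u + kmap (res_diff P n) v) set0 = kdX u set0 + res_diff P n (v set0).
  by rewrite [LHS]ffunE [X in _ + X]ffunE.
by rewrite linearD (maxideal_mul_residue _ (kd_maxideal u set0)) add0r g0.
Qed.

Lemma coboundary_zigzag n (phi : P n -> kk) z w : kdX z = 0 ->
  coboundary phi -> @zigzag z n 0 w -> phi (w set0) = 0.
Proof.
move=> zc; case: n phi w => [|n] phi w /= phi0 [_ wz]; first exact: phi0.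
have [chi ->] := phi0; have [w0 _ /ffunP/(_ set0)] := wz.
rewrite [RHS]ffunE => <-; apply: maxideal_mul_residue; exact: kd_maxideal.
Qed.

(* Every functional on a subspace of the Koszul homology of M, given by its      *)
(* graph L, is the evaluation of a cocycle.                                      *)
Lemma cocycle_of_functional n (L : kos M * k -> Prop) :
    L (0, 0) -> residue_relation L -> (forall y a, L (kdX y, a) -> a = 0) ->
  exists2 gamma : {linear P n -> kk}, cocycle gamma &
    forall z a w, L (z, a) -> zigzag z 0 w -> gamma (w set0) = a.
Proof.
move=> L0 Llin Lb.
pose G (p : P n * k) := exists z w v,
  [/\ L (z, p.2), zigzag z 0 w & p.1 = w set0 + res_diff P n v].
have [||u a um|gamma gE] := @residue_extension k m (P n) G.
- by exists 0, 0, 0; split; [|apply: zigzag0|rewrite ffunE linear0 addr0].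
- move=> s p q [z [w [v [Lz wz pE]]]] [z' [w' [v' [Lz' wz' qE]]]].
  exists (s *: z + z'), (s *: w + w'), (s *: v + v'); split.
  + exact: Llin Lz Lz'.
  + exact: zigzag_lin.
  + by rewrite /= pE qE linearP !ffunE scalerDr addrACA.
- case=> z [w [v [/= Lz wz uE]]]; have [y yE] := maxideal_kd um.
  have [y' y'z] : exists y', kdX y' = z.
    apply: (zigzag_boundary_conv (u := y) (v := kunit set0 (- v)) wz).
    rewrite yE kmap_unit (zigzag_end wz); apply/ffunP=> A; rewrite !ffunE uE.
    by case: ifP; rewrite ?addr0 // linearN addrK.
  by apply: (Lb y'); rewrite y'z.
exists gamma => [v|z a w Lz wz]; apply: gE.
  by exists 0, 0, v; split; [|apply: zigzag0|rewrite ffunE add0r].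
by exists z, w, 0; split=> //; rewrite linear0 addr0.
Qed.

Lemma cocycle_detect n (z : kos M) w : kdX z = 0 -> (forall y, kdX y <> z) ->
    zigzag z 0 w ->
  exists2 gamma : {linear P n -> kk}, cocycle gamma & gamma (w set0) = 1 :> k.
Proof.
move=> zc znb wz.
pose L (p : kos M * k) := exists2 s : S, p.1 = s *: z & p.2 = ev s.
have [|||gamma g0 gE] := @cocycle_of_functional n L.
- by exists 0; rewrite ?scale0r ?meval0.
- move=> s p q [t -> ->] [t' -> ->]; exists (s * t + t').
    by rewrite scalerDl scalerA.
  by rewrite mevalD mevalM.
- move=> y a [s /= yE ->]; apply/eqP/negPn/negP => s0.
  have [|y' y'E] := @cycle_maxideal M z (1 - (ev s)^-1%:MP * s) zc.
    by rewrite mevalB meval1 mevalM mevalC mulVf ?subrr.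
  apply: (znb ((ev s)^-1%:MP *: y + y')); rewrite linearP /= yE y'E.
  by rewrite scalerA -scalerDl addrC subrK scale1r.
exists gamma => //; apply: (gE z) => //.
by exists 1; rewrite ?scale1r ?meval1.
Qed.

Lemma zigzag_to_end n (u : P n) : liftable (kunit set0 u) ->
  exists z, [/\ khom n z, kdX z = 0 & zigzag z 0 (kunit set0 u)].
Proof.
move=> ul; have [|z [zh zc uz]] := zigzag_rev (e := 0) _ ul.
  by have := @khom_unit m S _ set0 u; rewrite cards0.
by exists z; split=> //; rewrite addn0 in zh.
Qed.

Lemma kunitE (N : lmodType S) B (v : N) : kunit B v B = v.
Proof. by rewrite ffunE eqxx. Qed.

Lemma cocycle_coboundary n (gamma : {linear P n -> kk}) : cocycle gamma ->
    (forall z w, khom n z -> kdX z = 0 -> zigzag z 0 w -> gamma (w set0) = 0) ->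
  coboundary gamma.
Proof.
case: n gamma => [|n] gamma g0 gz /=.
  move=> u; have [|z [zh zc uz]] := @zigzag_to_end 0 u.
    apply: kd_hom0; rewrite kmap_unit.
    by have := @khom_unit m S _ set0 (res_aug P u); rewrite cards0.
  by have := gz _ _ zh zc uz; rewrite kunitE.
pose G (p : P n * k) := exists2 u, p.1 = res_diff P n u & p.2 = gamma u.
have [|||chi chiE] := @residue_extension k m (P n) G.
- by exists 0; rewrite linear0.
- move=> s p q [u -> ->] [v -> ->]; exists (s *: u + v); first by rewrite linearP.
  by rewrite linearP.
- move=> v a um [u /= vE ->]; rewrite vE in um.
  have [y yE] := maxideal_kd um.
  have [|z [zh zc uz]] := @zigzag_to_end n.+1 u.
    by exists y; rewrite yE kmap_unit.
  by have := gz _ _ zh zc uz; rewrite kunitE.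
exists chi => u; apply/esym/chiE; by exists u.
Qed.
End Resolution.

Lemma zigzag_map (M N : lmodType S) (P : proj_resolution M) (Q : proj_resolution N)
    (phi : {linear M -> N}) (f : forall i, {linear P i -> Q i}) z n e w :
    (forall u, res_aug Q (f 0 u) = phi (res_aug P u)) ->
    (forall i u, res_diff Q i (f i.+1 u) = f i (res_diff P i u)) ->
  @zigzag M P z n e w -> zigzag (kmap phi z) e (kmap (f n) w).
Proof.
move=> f0 fS; elim: n e w => [|n IHn] e w /= [wh wz]; split; try exact: khom_map.
  by rewrite -wz; apply/ffunP=> A; rewrite !ffunE f0.
have [w0 w0z w0w] := wz; exists (kmap (f n) w0); first exact: IHn.
by rewrite kd_map w0w; apply/ffunP=> A; rewrite !ffunE fS.
Qed.

End Zigzags.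

(** * Quasi-Koszul modules *)

Section QuasiKoszul.
Variables (k : fieldType) (m : nat).
Local Notation S := {mpoly k[m]}.
Local Notation kk := (residue_field k : lmodType S).
Local Notation kos N := {ffun {set 'I_m} -> N}.
Local Notation kdX := (kd (@vars k m)).

(* P with its modules indexed by i + 0, the form in which Defs.v uses them.      *)
Definition shift0 (R : comNzRingType) (M : lmodType R) (P : proj_resolution M) :
    proj_resolution M :=
  @ProjResolution R M (fun i => P (i + 0)%N) (fun i => res_diff P (i + 0)%N)
    (res_aug P) (fun i => @res_proj R M P (i + 0)%N)
    (fun i => @res_exact R M P (i + 0)%N) (@res_exact0 R M P) (@res_surj R M P).

Lemma coboundary_shift0 (R : comNzRingType) (M N : lmodType R)
    (P : proj_resolution M) n (phi : P (n + 0)%N -> N) :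
  coboundary (P := shift0 P) (n := n) phi <-> coboundary phi.
Proof. by case: n phi. Qed.

Lemma coboundary0 (R : comNzRingType) (M N : lmodType R)
    (P : proj_resolution M) n (phi : P n -> N) :
  (forall x, phi x = 0) -> coboundary phi.
Proof. by case: n phi => [|n] phi phi0 //; exists \0. Qed.

Variable M : lmodType S.

(* Tor_n(M, k) -> Lambda^n (x) M/mM is injective for all n.                      *)
Definition koszul_detected : Prop :=
  forall n (z : kos M), khom n z -> kdX z = 0 ->
  (forall A, maxideal_mul (z A)) -> exists y, kdX y = z.

Lemma quasi_koszul_detected : quasi_koszul M -> koszul_detected.
Proof.
move=> qk n z zh zc zm; apply: contrapT => /forallNP znb.
have P := free_resolution M; have Q := free_resolution kk.
have [|w wz] := @zigzag_exists k m M (shift0 P) z n 0 zc; first by rewrite addn0.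
have [gamma g0 gw] := cocycle_detect zc znb wz.
have [r [psi [phi [delta [D gD]]]]] := qk P Q n gamma g0.
have {gD} /(coboundary_zigzag zc)/(_ wz) := (coboundary_shift0 _).2 gD.
move/eqP; rewrite subr_eq0 gw big1 ?(negPf (oner_neq0 _)) // => l _.
have [psi0 phi0 [f [f0 fS] df]] := D l.
have {df} /(coboundary_zigzag zc)/(_ wz)/eqP := (coboundary_shift0 _).2 df.
rewrite subr_eq0 => /eqP->.
have [|phib phibE] := linear_factor (g := res_aug P) (f := phi l) (@res_surj _ M P).
  by move=> u /res_exact0[v <-]; apply: phi0.
have fz := @zigzag_map k m M kk (shift0 P) Q phib f z n 0 w _ fS wz.
have {fz} := fz (fun u => etrans (f0 u) (esym (phibE u))).
have -> : kmap phib z = kdX 0.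
  by rewrite linear0; apply/ffunP=> A; rewrite !ffunE maxideal_mul_residue.
by move=> /(cocycle_boundary psi0); rewrite ffunE.
Qed.

Lemma ksum_unit (N : lmodType S) (z : kos N) : \sum_A kunit A (z A) = z.
Proof.
apply/ffunP=> B; rewrite sum_ffunE (bigD1 B) //= kunitE big1 ?addr0 // => A AB.
by rewrite ffunE eq_sym (negPf AB).
Qed.

Lemma detected_quasi_koszul : koszul_detected -> quasi_koszul M.
Proof.
move=> kdet P Q n gamma g0.
pose G (p : kos M * k) := exists w, [/\ khom n p.1, kdX p.1 = 0,
  @zigzag k m M (shift0 P) p.1 n 0 w & p.2 = gamma (w set0)].
have g0' : cocycle (P := shift0 P) (n := n) gamma by [].
have [|||Lam LamE] := @residue_extension k m (kos M) G.
- exists 0; split; [exact: linear0|exact: linear0|exact: zigzag0|].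
  by rewrite ffunE linear0.
- move=> s p q [w [ph pc wp pE]] [v [qh qc vq qE]]; exists (s *: w + v); split=> /=.
  + exact: khom_lin.
  + by rewrite linearP /= pc qc scaler0 addr0.
  + exact: zigzag_lin.
  + by rewrite pE qE !ffunE linearP.
- move=> z a [y /ffunP zy] [w [/= zh zc wz ->]].
  have [A|y' y'z] := kdet n z zh zc.
    exists (fun i => y i A); rewrite zy sum_ffunE; apply: eq_bigr => i _.
    by rewrite ffunE.
  by rewrite -y'z in wz; apply: cocycle_boundary wz.
have unitl A : linear (fun v : M => Lam (kunit A v)).
  move=> s u v; rewrite -linearP; congr (Lam _); apply/ffunP=> B; rewrite !ffunE.
  by case: ifP; rewrite ?scaler0 ?addr0.
pose phib A : {linear M -> kk} := HB.pack (fun v : M => Lam (kunit A v))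
  (GRing.isLinear.Build S M kk _ _ (unitl A)).
pose phi A : {linear P 0 -> kk} := phib A \o res_aug P.
have phi0 A : cocycle (phi A).
  move=> u; have aug0 : res_aug P (res_diff P 0 u) = 0.
    by apply/res_exact0; exists u.
  exact: etrans (congr1 (phib A) aug0) (linear0 _).
have /boolp.choice[psi psiE] A : exists psi : {linear Q n -> kk}, cocycle psi /\
    forall z w, zigzag z 0 w -> psi (w set0) = z A.
  pose L (p : kos kk * k) := p.2 = p.1 A.
  have [|||psi psi0 psiE] := @cocycle_of_functional k m kk Q n L.
  - by rewrite /L ffunE.
  - by move=> s p q pL qL; rewrite /L /= pL qL !ffunE.
  - by move=> y a; rewrite /L /= kd_residue ffunE.
  by exists psi; split=> // z w; apply: psiE.
have /boolp.choice[f fE] A := chain_lift_exists (P := shift0 P) Q (phi0 A).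
pose delta A : {linear P (n + 0)%N -> kk} := psi A \o f A n.
exists #|{set 'I_m}|, (psi \o enum_val), (phi \o enum_val), (delta \o enum_val).
split=> [l|].
  have [psi0 _] := psiE (enum_val l).
  split; [exact: psi0|exact: phi0|exists (f (enum_val l))]; first exact: fE.
  by apply: coboundary0 => u; rewrite subrr.
have hl : linear (fun u : P (n + 0)%N =>
    gamma u - \sum_(l < #|{set 'I_m}|) (delta \o enum_val) l u).
  move=> s u v; rewrite linearP scalerBr addrACA -opprD scaler_sumr -big_split.
  by congr (_ - _); apply: eq_bigr => l _; rewrite linearP.
pose h : {linear P (n + 0)%N -> kk} := HB.pack (fun u : P (n + 0)%N =>
    gamma u - \sum_(l < #|{set 'I_m}|) (delta \o enum_val) l u)
  (GRing.isLinear.Build S (P (n + 0)%N) kk _ _ hl).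
apply/coboundary_shift0.
apply: (@cocycle_coboundary k m M (shift0 P) n h) => [u|z w zh zc wz].
  rewrite /h /= g0 big1 ?subr0 // => l _.
  have [_ /= fS] := fE (enum_val l); rewrite -fS.
  by have [psi0 _] := psiE (enum_val l); apply: psi0.
rewrite /h /= -(LamE z (gamma (w set0))); last by exists w.
rewrite -{1}[z]ksum_unit linear_sum /= [X in X - _]big_enum_val.
apply/eqP; rewrite subr_eq0; apply/eqP; apply: eq_bigr => l _.
have [_ /(_ (kmap (phib (enum_val l)) z) (kmap (f (enum_val l) n) w)) pE] :=
  psiE (enum_val l).
have [f0 fS] := fE (enum_val l).
by move: (pE (zigzag_map (phi := phib (enum_val l)) f0 fS wz)); rewrite !ffunE.
Qed.

End QuasiKoszul.

(** * Complementary duality of simplicial chains *)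

Section Duality.
Variables (k : fieldType) (m : nat).
Local Notation chain := {ffun {set 'I_m} -> k^o}.
Implicit Types (A B I U s : {set 'I_m}) (c e : chain).
Local Notation bd := (kd (fun=> 1 : k)).
Local Notation sub U := (fun s : {set 'I_m} => s \subset U).

Definition supported (P : pred {set 'I_m}) c : Prop := forall s, c s != 0 -> P s.

Lemma supportedP P c s : supported P c -> ~~ P s -> c s = 0.
Proof. by move=> cP Ps; apply/eqP; apply: contraNT Ps; apply: cP. Qed.

Lemma simplex_neq0 A B : simplex k A B != 0 -> B = A.
Proof. by rewrite ffunE; case: (eqVneq B A) => //; rewrite eqxx. Qed.

Lemma khom_simplex A : khom #|A| (simplex k A).
Proof.
apply/ffunP=> B; rewrite !ffunE.
by case: (eqVneq B A) => [->|]; rewrite ?eqxx ?if_same.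
Qed.

Lemma sum_simplexE (P : pred {set 'I_m}) c t :
  (\sum_(s | P s) c s *: simplex k s) t = if P t then c t else 0.
Proof.
have E s : (c s *: simplex k s) t = c s * (t == s)%:R by rewrite !ffunE.
rewrite sum_ffunE (eq_bigr _ (fun s _ => E s)); case: ifP => Pt.
  rewrite (bigD1 t) //= eqxx mulr1 big1 ?addr0 // => s /andP[_ /negPf st].
  by rewrite eq_sym st mulr0.
by apply: big1 => s Ps; case: eqP Ps Pt => [-> ->|]; rewrite ?mulr0.
Qed.

Lemma chain_sum c : c = \sum_s c s *: simplex k s.
Proof. by apply/ffunP=> t; rewrite sum_simplexE. Qed.

Lemma mem_span_simplex (P : {pred {set 'I_m}}) c :
  reflect (supported (mem P) c) (c \in <<[seq simplex k s | s in P]>>%VS).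
Proof.
apply: (iffP idP) => [|cP].
  move=> cspan s; apply: contraNT => sP.
  have evl : linear (fun d : chain => d s : k^o) by move=> a d d'; rewrite !ffunE.
  pose ev : {linear chain -> k^o} := HB.pack (fun d : chain => d s : k^o)
    (GRing.isLinear.Build k chain k^o _ _ evl).
  have /subvP/(_ c cspan) : (<<[seq simplex k t | t in P]>> <= lker (linfun ev))%VS.
    apply/span_subvP => d /imageP[t tP ->]; rewrite memv_ker lfunE /= ffunE.
    by case: (eqVneq s t) sP => [->|//]; rewrite /= tP.
  by rewrite memv_ker lfunE.
rewrite [c]chain_sum; apply: memv_suml => s _.
have [->|/cP sP] := eqVneq (c s) 0; first by rewrite scale0r mem0v.
by apply/memvZ/memv_span/image_f.
Qed.

Lemma kd_supported_sub U c :
  supported (sub U) c -> supported (sub U) (bd c).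
Proof.
move=> cU s; rewrite ffunE => /eqP; apply: contra_notT => sU; apply: big1 => i _.
rewrite (supportedP cU) ?scaler0 //; apply: contra sU; apply: subset_trans.
exact: subsetUr.
Qed.

Lemma wedge_supported_sub U j c : j \in U ->
  supported (sub U) c -> supported (sub U) (kos_wedge j c).
Proof.
move=> jU cU s; rewrite ffunE; case: ifP => [js|]; last by rewrite eqxx.
rewrite scaler_eq0 negb_or => /andP[_ /cU sU].
by rewrite -(setD1K js) subUset sub1set jU.
Qed.

Lemma kd_wedge_cycle j c : bd c = 0 -> bd (kos_wedge j c) = c.
Proof.
by move=> c0; have := kd_wedge (fun=> 1 : k) j c; rewrite c0 kos_wedge0 addr0 scale1r.
Qed.

Lemma wedge_hom j n c : khom n c -> khom n.+1 (kos_wedge j c).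
Proof.
move=> ch; apply/ffunP=> s; rewrite !ffunE; case: ifP => // sn; case: ifP => // js.
rewrite (khom0 ch) ?scaler0 //; apply: contraFN sn => /eqP <-.
by rewrite (cardsD1 j s) js.
Qed.

Lemma chain_separation (W : {vspace chain}) e : e \notin W ->
  exists d : chain, (forall w, w \in W -> \sum_s d s * w s = 0) /\
    \sum_s d s * e s != 0.
Proof.
move=> eW; pose f := (\1 - projv W)%VF.
have fW w : w \in W -> f w = 0.
  by move=> wW; rewrite add_lfunE opp_lfunE id_lfunE projv_id ?subrr.
have [s es] : exists s, f e s != 0.
  apply/existsP; apply: contraNT eW; rewrite negb_exists => /forallP e0.
  have -> : e = projv W e; last exact: memv_proj.
  apply/eqP; rewrite -subr_eq0; apply/eqP/ffunP=> s.
  have /negPn/eqP := e0 s.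
  by rewrite add_lfunE opp_lfunE id_lfunE => ->; rewrite ffunE.
exists [ffun t => f (simplex k t) s].
have E (w : chain) : \sum_t [ffun t => f (simplex k t) s] t * w t = f w s.
  rewrite [in RHS](chain_sum w) linear_sum sum_ffunE; apply: eq_bigr => t _.
  by rewrite ffunE linearZ ffunE mulrC.
by split=> [w wW|]; rewrite E // fW // ffunE.
Qed.

(* The sign for which A |-> U \ A turns the boundary into its transpose.      *)
Definition compl_sign U A : k := \prod_(a in A) (-1) ^+ kos_sign U a.

Lemma compl_signK U A : compl_sign U A * compl_sign U A = 1.
Proof.
rewrite /compl_sign -big_split big1 //= => a _.
by rewrite -signr_addb addbb.
Qed.

Definition compl_pairing U c e : k :=
  \sum_(A : {set 'I_m} | A \subset U) compl_sign U A * (c A * e (U :\: A)).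

Lemma kos_sign_split U A i : A \subset U ->
  kos_sign U i = kos_sign A i (+) kos_sign (U :\: A) i.
Proof.
move=> AU; rewrite /kos_sign -oddD -cardsUI.
rewrite [X in (_ + #|pred_of_set X|)%N](_ : _ = set0) ?cards0 ?addn0.
  congr (odd #|pred_of_set _|); apply/setP=> j; rewrite !inE -andb_orl.
  by case: (boolP (j \in A)) => // /(subsetP AU)->.
by apply/setP=> j; rewrite !inE; case: (j \in A); rewrite ?andbF.
Qed.

Lemma compl_pairing_kd U c e :
    supported (sub U) c -> supported (sub U) e ->
  compl_pairing U (bd c) e = compl_pairing U c (bd e).
Proof.
move=> cU eU; rewrite /compl_pairing.
pose F i A : k := compl_sign U A * ((-1) ^+ kos_sign A i * c (i |: A) * e (U :\: A)).
pose G i B : k := compl_sign U B *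
  (c B * ((-1) ^+ kos_sign (U :\: B) i * e (i |: (U :\: B)))).
transitivity (\sum_(i in U) \sum_(A : {set 'I_m} | (A \subset U) && (i \notin A)) F i A).
  rewrite (exchange_big_dep (sub U)) /=; last by move=> i A _ /andP[].
  apply: eq_bigr => A AU; rewrite ffunE mulr_suml mulr_sumr.
  rewrite (bigID (mem U)) /= [X in _ + X]big1 ?addr0 => [|i /andP[iA iU]].
    by apply: eq_big => [i|i _]; rewrite ?AU 1?andbC // /F scale1r.
  rewrite (supportedP cU) ?scaler0 ?mul0r ?mulr0 //; apply: contra iU.
  by move/subsetP; apply; rewrite setU11.
transitivity (\sum_(i in U) \sum_(B : {set 'I_m} | (B \subset U) && (i \in B)) G i B); last first.
  rewrite (exchange_big_dep (sub U)) /=; last by move=> i A _ /andP[].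
  apply: eq_bigr => B BU; rewrite ffunE !mulr_sumr.
  rewrite [in RHS](bigID (mem U)) /= [X in _ + X]big1 ?addr0 => [|i /andP[iA iU]].
    apply: eq_big => [i|i _]; rewrite ?BU /G ?scale1r // !inE.
    by case: (i \in B); case: (i \in U).
  rewrite (supportedP eU) ?scaler0 ?mulr0 //; apply: contra iU.
  by move/subsetP; apply; rewrite setU11.
apply: eq_bigr => i iU.
rewrite (reindex_onto (fun B => B :\ i) (fun A => i |: A)) /=; last first.
  by move=> A /andP[_ iA]; rewrite setU1K.
apply: eq_big => [B|B /andP[/andP[BU _] /eqP iB]].
  rewrite setD11 andbT; case: (boolP (i \in B)) => iB.
    by rewrite setD1K // eqxx !andbT -{2}(setD1K iB) subUset sub1set iU.
  rewrite andbF; apply/negbTE; rewrite negb_and; apply/orP; right.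
  by apply: contra iB => /eqP <-; rewrite setU11.
have {iB BU} [A [iA -> AU]] : exists A : {set 'I_m}, [/\ i \notin A, B = i |: A & A \subset U].
  by exists (B :\ i); rewrite setD11 iB.
have UA : i |: (U :\: (i |: A)) = U :\: A.
  apply/setP=> j; rewrite !inE.
  by case: (eqVneq j i) => [->|] //=; rewrite iA iU.
rewrite /F /G setU1K // UA /compl_sign big_setU1 //=.
have -> : kos_sign (U :\: (i |: A)) i = kos_sign (U :\: A) i.
  by rewrite -UA kos_signU ?ltnn // !inE eqxx.
rewrite (kos_sign_split i AU) signr_addb.
set x := \prod_(_ in _) _; set y := (-1) ^+ kos_sign A i; set t := (-1) ^+ kos_sign _ i.
have tt : t * t = 1 by rewrite /t -signr_addb addbb.
by rewrite -[y in LHS]mulr1 -tt; ring.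
Qed.

End Duality.

(** * Homology generated by missing faces *)

Section HMFDuality.
Variables (k : fieldType) (m : nat) (K : {set {set 'I_m}}).
Hypothesis hK : simplicial_complex K.
Local Notation chain := {ffun {set 'I_m} -> k^o}.
Implicit Types (A B I U s : {set 'I_m}) (c e : chain).
Local Notation bd := (kd (fun=> 1 : k)).
Local Notation sub U := (fun s : {set 'I_m} => s \subset U).

Lemma compl_pairing_trunc U n c e : khom n c ->
  compl_pairing U c (ktrunc (#|U| - n)%N e) = compl_pairing U c e.
Proof.
move=> ch; apply: eq_bigr => A AU; rewrite ffunE.
have [An|An] := eqVneq #|A| n; first by rewrite cardsDS // An eqxx.
by rewrite (khom0 ch An) !mul0r.
Qed.

Lemma compl_pairing_eq0 U c e :
  (forall A, A \subset U -> c A != 0 -> e (U :\: A) = 0) -> compl_pairing U c e = 0.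
Proof.
move=> ce; apply: big1 => A AU; have [->|/(ce A AU)->] := eqVneq (c A) 0.
  by rewrite mul0r mulr0.
by rewrite !mulr0.
Qed.

Lemma compl_pairingDr U c e e' :
  compl_pairing U c (e + e') = compl_pairing U c e + compl_pairing U c e'.
Proof.
by rewrite -big_split; apply: eq_bigr => A _; rewrite ffunE mulrDr mulrDr.
Qed.

Lemma compl_pairing_simplexr U c s : s \subset U ->
  compl_pairing U c (simplex k s) = compl_sign k U (U :\: s) * c (U :\: s).
Proof.
move=> sU; rewrite /compl_pairing (bigD1 (U :\: s)) ?subsetDl //= big1 ?addr0.
  by rewrite ffunE setDDr setDv set0U (setIidPr sU) eqxx mulr1.
move=> A /andP[AU As]; rewrite ffunE; case: eqP => [sE|]; last by rewrite !mulr0.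
by rewrite -sE setDDr setDv set0U (setIidPr AU) eqxx in As.
Qed.

Lemma compl_pairing_simplexl U A e : A \subset U ->
  compl_pairing U (simplex k A) e = compl_sign k U A * e (U :\: A).
Proof.
move=> AU; rewrite /compl_pairing (bigD1 A) //= big1 ?addr0.
  by rewrite ffunE eqxx mul1r.
by move=> B /andP[_ /negPf BA]; rewrite ffunE BA mul0r mulr0.
Qed.

Lemma compl_separationl U (W : {vspace chain}) c :
    c \notin W -> supported (sub U) c ->
  exists e, [/\ supported (sub U) e, compl_pairing U c e != 0 &
    forall w, w \in W -> supported (sub U) w -> compl_pairing U w e = 0].
Proof.
move=> /chain_separation[d [dW dc]] cU.
pose e : chain := [ffun s : {set 'I_m} => if s \subset U then
  compl_sign k U (U :\: s) * d (U :\: s) else 0].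
have E w : supported (sub U) w -> compl_pairing U w e = \sum_A d A * w A.
  move=> wU; rewrite [RHS](bigID (sub U)) /= [X in _ + X]big1 ?addr0.
    apply: eq_bigr => A AU; rewrite ffunE subsetDl setDDr setDv set0U (setIidPr AU).
    by rewrite mulrCA (mulrA (compl_sign _ _ _)) compl_signK mul1r mulrC.
  by move=> A AU; rewrite (supportedP wU) ?mulr0.
exists e; split=> [s|| w wW wU]; rewrite ?E //; last exact: dW.
by rewrite ffunE; case: ifP; rewrite ?eqxx.
Qed.

Lemma compl_separationr U (W : {vspace chain}) e :
    e \notin W -> supported (sub U) e ->
  exists c, [/\ supported (sub U) c, compl_pairing U c e != 0 &
    forall w, w \in W -> supported (sub U) w -> compl_pairing U c w = 0].
Proof.
move=> /chain_separation[d [dW de]] eU.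
pose c : chain := [ffun A : {set 'I_m} => if A \subset U then
  compl_sign k U A * d (U :\: A) else 0].
have E w : supported (sub U) w -> compl_pairing U c w = \sum_s d s * w s.
  move=> wU; rewrite [RHS](bigID (sub U)) /= [X in _ + X]big1 ?addr0; last first.
    by move=> A AU; rewrite (supportedP wU) ?mulr0.
  rewrite [RHS](reindex_onto (fun A => U :\: A) (fun A => U :\: A)) /=; last first.
    by move=> A AU; rewrite setDDr setDv set0U (setIidPr AU).
  apply: eq_big => A; last first.
    by move=> AU; rewrite ffunE AU !mulrA compl_signK mul1r.
  rewrite subsetDl /= setDDr setDv set0U; apply/idP/eqP => [/setIidPr//|<-].
  exact: subsetIl.
exists c; split=> [s|| w wW wU]; rewrite ?E //; last exact: dW.
by rewrite ffunE; case: ifP; rewrite ?eqxx.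
Qed.

Lemma set0_face : set0 \in K.
Proof.
have [/set0Pn[s sK] down _] := hK; apply: down sK _; exact: sub0set.
Qed.

Lemma missing_face_sub I s : missing_face K I -> s \subset I -> (s == I) || (s \in K).
Proof.
case/andP=> _ /forallP/(_ s)/implyP Is sI; rewrite orbC -implyNb.
apply/implyP; apply: contraNT => sI'; apply: Is.
by rewrite properEneq sI' sI.
Qed.

Lemma missing_face_neq0 I : missing_face K I -> exists i, i \in I.
Proof.
by case/andP=> IK _; apply/set0Pn; apply: contraNneq IK => ->; apply: set0_face.
Qed.

Lemma mem_cycles U n c :
  c \in cycles k (full_subcomplex K U) n ->
  [/\ supported [pred s : {set 'I_m} | (s \in K) && (s \subset U)] c, khom n c & bd c = 0].
Proof.
rewrite memv_cap memv_ker lfunE /= boundaryE => /andP[/mem_span_simplex cP /eqP c0].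
split=> // [s /cP|]; first by rewrite !inE => /andP[].
apply/ffunP=> s; rewrite ffunE; case: ifP => // sn; apply/esym/eqP.
by apply: contraFT sn => /cP; rewrite !inE => /andP[].
Qed.

Lemma cycles_mem U n c :
  supported [pred s : {set 'I_m} | (s \in K) && (s \subset U)] c -> khom n c -> bd c = 0 ->
  c \in cycles k (full_subcomplex K U) n.
Proof.
move=> cU ch c0; rewrite memv_cap memv_ker lfunE /= boundaryE c0 eqxx andbT.
apply/mem_span_simplex => s cs; rewrite !inE; have /andP[-> ->] := cU s cs.
by apply: contraNT cs => sn; rewrite (khom0 ch).
Qed.

Definition cosupported U c : Prop :=
  supported [pred A : {set 'I_m} | (A \subset U) && (U :\: A \notin K)] c.

(* A relative cocycle of K_U in the full simplex on U that vanishes on the       *)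
(* missing faces is a coboundary; a cochain on the faces s is written as the     *)
(* chain A = U \ s.                                                              *)
Definition cocycle_detected : Prop := forall U n c, khom n c -> bd c = 0 ->
  cosupported U c -> (forall A, c A != 0 -> ~~ missing_face K (U :\: A)) ->
  exists2 c', cosupported U c' & bd c' = c.

Definition filled U :=
  [pred s : {set 'I_m} | (s \subset U) && ((s \in K) || missing_face K s)].

Lemma HMF_filling U n e : HMF k K -> U != set0 ->
    supported [pred s : {set 'I_m} | (s \in K) && (s \subset U)] e -> khom n e -> bd e = 0 ->
  exists2 g, supported (filled U) g & bd g = e.
Proof.
move=> hmf U0 eU eh e0; have /subvP/(_ e (cycles_mem eU eh e0)) := hmf U U0 n.
case/memv_addP=> _ /memv_imgP[g gK ->] [_ /memv_sumP[f fc ->] ->].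
have /boolp.choice[h hE] I : exists h : chain, missing_face K I && (I \subset U) ->
    supported (filled U) h /\ bd h = f I.
  case: (boolP (_ && _)) => [/andP[Im IU]|_]; last by exists 0.
  have [i iI] := missing_face_neq0 Im.
  have [|fI _ f0] := @mem_cycles I n (f I); first by apply: fc; rewrite Im IU.
  exists (kos_wedge i (f I)) => _; split; last exact: kd_wedge_cycle.
  move=> s sh; have sI : s \subset I.
    by apply: wedge_supported_sub sh => // t /fI/andP[].
  rewrite /= (subset_trans sI IU) /=.
  by case/orP: (missing_face_sub Im sI) => [/eqP->|->//]; rewrite Im orbT.
exists (g + \sum_(I | missing_face K I && (I \subset U)) h I).
  move=> s; rewrite ffunE sum_ffunE => ghs.
  have [gs|gs] := eqVneq (g s) 0; last first.
    by move/mem_span_simplex: gK => /(_ s gs); rewrite !inE => /andP[/andP[-> ->]].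
  move: ghs; rewrite gs add0r => /eqP; apply: contra_notT => sF.
  by apply: big1 => I /hE[hF _]; apply: supportedP sF.
rewrite linearD linear_sum lfunE /= boundaryE; congr (_ + _).
by apply: eq_bigr => I /hE[_ <-].
Qed.

Lemma HMF_cocycle_detected : HMF k K -> cocycle_detected.
Proof.
move=> hmf U n c ch c0 cU cm.
pose D := [pred A : {set 'I_m} | (A \subset U) && (U :\: A \notin K)].
pose W := (linfun (@boundary k m) @: <<[seq simplex k A | A in D]>>)%VS.
have [/memv_imgP[c' /mem_span_simplex c'U ->]|cW] := boolP (c \in W).
  by exists c'; rewrite ?lfunE /= ?boundaryE.
have cUs : supported (sub U) c by move=> A /cU/andP[].
have [e [eU ce We]] := compl_separationl cW cUs.
have be_K : supported [pred s : {set 'I_m} | (s \in K) && (s \subset U)] (bd e).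
  move=> s bes; have sU := kd_supported_sub eU bes; rewrite /= sU andbT.
  apply: contraNT bes => sK; have UsU : U :\: s \subset U by apply: subsetDl.
  have ss : supported (sub U) (simplex k (U :\: s)).
    by move=> A /simplex_neq0->.
  have UUs : U :\: (U :\: s) = s by rewrite setDDr setDv set0U (setIidPr sU).
  have : compl_pairing U (bd (simplex k (U :\: s))) e = 0.
    apply: We; last exact: kd_supported_sub.
    apply/memv_imgP; exists (simplex k (U :\: s)); last by rewrite lfunE /= boundaryE.
    apply: memv_span; apply: image_f; rewrite inE UsU UUs; exact: sK.
  rewrite compl_pairing_kd // compl_pairing_simplexl // UUs.
  move=> /(congr1 ( *%R (compl_sign k U (U :\: s)))).
  by rewrite mulrA compl_signK mul1r mulr0 => ->.
have [A cA] : exists A, c A != 0.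
  apply/existsP; apply: contraNT cW; rewrite negb_exists => /forallP c0'.
  suff -> : c = 0 by apply: mem0v.
  by apply/ffunP=> A; rewrite ffunE; apply/eqP/negPn.
have [AU UA] := andP (cU _ cA).
have An : #|A| = n by apply/eqP; apply: contraNT cA => An; rewrite (khom0 ch An).
have /set0Pn[j] : U :\: A != set0 by apply: contraNneq UA => ->; apply: set0_face.
rewrite inE => /andP[jA jU].
have [p pE] : exists p, (#|U| - n)%N = p.+1.
  exists (#|U| - n).-1%N; rewrite prednK // subn_gt0 -An; apply: proper_card.
  by apply/properP; split=> //; exists j.
pose e1 := ktrunc p.+1 e.
have U0 : U != set0 by apply/set0Pn; exists j.
have [|||g gF gE] := @HMF_filling U p (bd e1) hmf U0.
- move=> s; rewrite kd_trunc ffunE; case: ifP => [_ /be_K//|]; by rewrite eqxx.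
- by rewrite kd_trunc; apply: khom_trunc.
- exact: kd_kd.
have fU : supported (sub U) (e1 - g).
  move=> s; rewrite !ffunE; have [gs|/gF/andP[]//] := eqVneq (g s) 0.
  by rewrite gs subr0; case: ifP => [_ /eU//|]; rewrite eqxx.
have fE : bd (kos_wedge j (e1 - g)) = e1 - g.
  by apply: kd_wedge_cycle; rewrite linearB /= gE subrr.
case/negP: ce; rewrite -(compl_pairing_trunc _ _ ch) pE -/e1 -(subrK g e1).
rewrite compl_pairingDr -fE -compl_pairing_kd //; last exact: wedge_supported_sub.
rewrite c0 [X in X + _]compl_pairing_eq0 ?add0r; last by move=> B _; rewrite ffunE eqxx.
rewrite compl_pairing_eq0 // => B BU cB; apply: (supportedP gF) => /=.
by rewrite negb_and negb_or (cm _ cB); have /andP[_ ->] := cU _ cB; rewrite orbT.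
Qed.

Lemma missing_boundary_cycle I n : missing_face K I -> #|I| = n.+1 ->
  bd (simplex k I) \in cycles k (full_subcomplex K I) n.
Proof.
move=> Im In; apply: cycles_mem; last exact: kd_kd.
  move=> s; rewrite ffunE => /eqP sI.
  have [i /andP[is_ sE]] : exists i, (i \notin s) && (i |: s == I).
    apply/existsP; apply: contra_notT sI; rewrite negb_exists => /forallP sI.
    apply: big1 => i is_; have := sI i; rewrite is_ /= ffunE => /negPf->.
    by rewrite !scaler0.
  rewrite -(eqP sE) in Im *; rewrite inE subsetUr andbT.
  case/orP: (missing_face_sub Im (subsetUr [set i] s)) => // /eqP sE'.
  by rewrite sE' setU11 in is_.
by apply: kd_hom; rewrite -In; apply: khom_simplex.
Qed.

Lemma cocycle_detected_HMF : cocycle_detected -> HMF k K.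
Proof.
move=> det U /set0Pn[j jU] n; apply/subvP => e /mem_cycles[eU eh e0].
have eUs : supported (sub U) e by move=> s /eU/andP[].
pose e2 := kos_wedge j e.
have e2E : bd e2 = e by apply: kd_wedge_cycle.
have e2U : supported (sub U) e2 by apply: wedge_supported_sub.
pose W := (<<[seq simplex k s | s in filled U]>> +
  linfun (@boundary k m) @: <<[seq simplex k s | s in sub U]>>)%VS.
have [|e2W] := boolP (e2 \in W).
  case/memv_addP=> g /mem_span_simplex gF [_ /memv_imgP[f _ ->] e2g].
  pose g1 := ktrunc n.+1 g.
  have g1F : supported (filled U) g1.
    by move=> s; rewrite ffunE; case: ifP => [_ /gF//|]; rewrite eqxx.
  have g1E : bd g1 = e.
    by rewrite kd_trunc -eh -[in RHS]e2E e2g linearD /= lfunE /= boundaryE kd_kd addr0.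
  pose gK : chain := [ffun s : {set 'I_m} => if s \in K then g1 s else 0].
  have g1S : g1 = gK + \sum_(I | missing_face K I && (I \subset U)) g1 I *: simplex k I.
    apply/ffunP=> s; rewrite [RHS]ffunE sum_simplexE [gK s]ffunE.
    have [->|/g1F/andP[sU sK]] := eqVneq (g1 s) 0; first by rewrite !if_same addr0.
    move: sK; rewrite sU andbT => /orP[sK|sm]; last first.
      by rewrite sm; have /andP[/negPf-> _] := sm; rewrite add0r.
    by rewrite sK /missing_face sK addr0.
  rewrite -g1E g1S linearD linear_sum; apply: memv_add.
    apply/memv_imgP; exists gK; last by rewrite lfunE /= boundaryE.
    apply/mem_span_simplex => s; rewrite ffunE; case: ifP => [sK g1s|]; last by rewrite eqxx.
    have /andP[sU _] := g1F s g1s; rewrite !inE sK sU /=.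
    by apply: contraNT g1s => sn; rewrite ffunE (negPf sn).
  apply: memv_sumr => I /andP[Im IU]; rewrite linearZ.
  have [In|In] := eqVneq #|I| n.+1.
    by apply: memvZ; apply: missing_boundary_cycle.
  by rewrite ffunE (negPf In) [X in X \in _]scale0r mem0v.
have [c [cU ce cW]] := compl_separationr e2W e2U.
have cW' s : s \subset U -> simplex k s \in W -> c (U :\: s) = 0.
  move=> sU sW; have sS : supported (sub U) (simplex k s) by move=> A /simplex_neq0->.
  have := cW _ sW sS; rewrite compl_pairing_simplexr //.
  move=> /(congr1 ( *%R (compl_sign k U (U :\: s)))).
  by rewrite mulrA compl_signK mul1r mulr0.
have cF A : A \subset U -> c A != 0 -> ~~ filled U (U :\: A).
  move=> AU; apply: contra => AF; rewrite -(setIidPr AU) -[U :&: A]set0U -(setDv U) -setDDr.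
  rewrite cW' ?subsetDl //; apply: (subvP (addvSl _ _)).
  by apply/memv_span/image_f.
pose q := (#|U| - n.+1)%N.
have c0 : bd c = 0.
  apply/ffunP=> A; rewrite [RHS]ffunE; apply/eqP; apply: contraT => cA.
  have AU := kd_supported_sub cU cA; have sU : U :\: A \subset U by apply: subsetDl.
  have sS : supported (sub U) (simplex k (U :\: A)) by move=> B /simplex_neq0->.
  have := compl_pairing_kd cU sS; rewrite cW; last exact: kd_supported_sub.
    rewrite compl_pairing_simplexr // setDDr setDv set0U (setIidPr AU).
    move=> /(congr1 ( *%R (compl_sign k U A))).
    by rewrite mulrA compl_signK mul1r mulr0 => /eqP; rewrite (negPf cA).
  apply: (subvP (addvSr _ _)); apply/memv_imgP; exists (simplex k (U :\: A)).
    by apply/memv_span/image_f.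
  by rewrite lfunE /= boundaryE.
have [||||c' c'U c'E] := det U q (ktrunc q c).
- exact: khom_trunc.
- case: q => [|q]; first exact/kd_hom0/khom_trunc.
  by rewrite kd_trunc c0 linear0.
- move=> A; rewrite ffunE; case: ifP => [_ cA|]; last by rewrite eqxx.
  have AU := cU _ cA; have := cF A AU cA.
  by rewrite /= subsetDl AU negb_or => /andP[].
- move=> A; rewrite ffunE; case: ifP => [_ cA|]; last by rewrite eqxx.
  by have := cF A (cU _ cA) cA; rewrite /= subsetDl negb_or => /andP[].
case/negP: ce; have <- : compl_pairing U (ktrunc q c) e2 = compl_pairing U c e2.
  apply: eq_bigr => A AU; rewrite ffunE; case: eqP => // Aq.
  rewrite (khom0 (wedge_hom j eh)) ?mulr0 //; apply: contra_notN Aq => /eqP.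
  by rewrite /q => <-; rewrite cardsDS // subKn // subset_leq_card.
rewrite -c'E compl_pairing_kd ?e2E //; last by move=> A /c'U/andP[].
apply/eqP; apply: compl_pairing_eq0 => A AU /c'U/andP[_ UA].
by apply: (supportedP eU); rewrite /= negb_and UA.
Qed.

End HMFDuality.

(** * The Koszul complex of the Stanley-Reisner ideal *)

Section StanleyReisnerKoszul.
Variables (k : fieldType) (m : nat) (K : {set {set 'I_m}}).
Hypothesis hK : simplicial_complex K.
Local Notation S := {mpoly k[m]}.
Local Notation kos N := {ffun {set 'I_m} -> N}.
Local Notation chain := {ffun {set 'I_m} -> k^o}.
Local Notation kdX := (kd (@vars k m)).
Local Notation bd := (kd (fun=> 1 : k)).
Local Notation IK := (SR_ideal k K : lmodType S).
Implicit Types (A B U s : {set 'I_m}) (b : 'X_{1..m}).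

Definition mnm_support b : {set 'I_m} := [set i | b i != 0%N].

Lemma smon_le A U : (smon A <= smon U)%MM = (A \subset U).
Proof.
apply/mnm_lepP/subsetP => [AU i iA|AU i].
  by have := AU i; rewrite !mnmE iA lt0b.
by rewrite !mnmE; case: (boolP (i \in A)) => // /AU->.
Qed.

Lemma smon_sub A U : A \subset U -> (smon U - smon A)%MM = smon (U :\: A).
Proof.
move=> AU; apply/mnmP=> i; rewrite !mnmE inE.
by case: (boolP (i \in A)) => [/(subsetP AU)->|] //=; rewrite subn0.
Qed.

Lemma support_smon A : mnm_support (smon A) = A.
Proof. by apply/setP=> i; rewrite inE mnmE; case: (i \in A). Qed.

Lemma stanley_reisnerP (p : S^o) :
  p \in stanley_reisner K <-> (forall b, p@_b != 0 -> mnm_support b \notin K).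
Proof.
split=> [/asboolP[q ->] b|pK].
  rewrite raddf_sum /=; apply: contraNN => bK; apply/eqP/big1 => s sK.
  rewrite prod_smon; apply/memN_msupp_eq0; apply: contra sK.
  rewrite (perm_mem (msuppMX _ _)) => /mapP[b' _ bE].
  have [_ down _] := hK; apply: down bK _; apply/subsetP => i is_.
  by rewrite inE bE mnmDE mnmE is_.
rewrite [p]mpolyE; apply: rpred_sum => b _.
have [->|/pK bK] := eqVneq p@_b 0; first by rewrite scale0r rpred0.
apply/asboolP; exists (fun s => if s == mnm_support b
  then p@_b *: 'X_[(b - smon (mnm_support b))%MM] else 0).
rewrite (bigD1 (mnm_support b)) //= eqxx prod_smon -scalerAl -mpolyXD submK.
  by rewrite big1 ?addr0 // => s /andP[_ /negPf->]; rewrite mul0r.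
by apply/mnm_lepP=> i; rewrite mnmE inE; case: (b i).
Qed.

Lemma stanley_reisner_smon s : s \notin K -> ('X_[smon s] : S^o) \in stanley_reisner K.
Proof.
move=> sK; apply/stanley_reisnerP => b; rewrite mcoeffX.
by case: (eqVneq (smon s) b) => [<-|]; rewrite ?support_smon // eqxx.
Qed.

Lemma maxideal_SR (p : IK) b : maxideal_mul p -> (SR_val p)@_b != 0 ->
  exists2 i, b i != 0%N & mnm_support (b - U_(i))%MM \notin K.
Proof.
case=> y pE bp.
have {}pE : SR_val p = \sum_i 'X_i * SR_val (y i).
  by have := congr1 (val : {linear IK -> S^o}) pE; rewrite linear_sum.
have /existsP[i bi] : [exists i, ('X_i * SR_val (y i))@_b != 0].
  apply: contraNT bp; rewrite negb_exists => /forallP y0.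
  by rewrite pE raddf_sum /=; apply/eqP/big1 => i _; apply/eqP/negPn.
have : b \in msupp (SR_val (y i) * 'X_i) by rewrite mcoeff_msupp mulrC.
rewrite (perm_mem (msuppMX _ _)) => /mapP[b' yb' ->]; exists i.
  by rewrite mnmDE mnm1E eqxx.
rewrite addmC addmK; have /stanley_reisnerP := SR_valP (y i); apply.
by rewrite -mcoeff_msupp.
Qed.

Lemma kos_stanley_reisner (y : kos S^o) : (forall A, y A \in stanley_reisner K) ->
  exists y' : kos IK, kmap (fun p => SR_val p : S^o) y' = y.
Proof. by move=> yK; apply: kmap_surj => A; exists (SRIdeal (yK A)). Qed.

Lemma kmap_SR_val_inj (z w : kos IK) :
  kmap (fun p => SR_val p : S^o) z = kmap (fun p => SR_val p : S^o) w -> z = w.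
Proof.
by move=> /ffunP zw; apply/ffunP=> A; apply: val_inj; have := zw A; rewrite !ffunE.
Qed.

Lemma kd_SR_val (z : kos IK) :
  kd (@vars k m) (kmap (fun p => SR_val p : S^o) z) = kmap (fun p => SR_val p : S^o) (kdX z).
Proof. exact: (kd_map _ (val : {linear IK -> S^o})). Qed.

Lemma kcoef_neq0_mcoeff b A (z : kos S^o) : kcoef b z A != 0 ->
  (smon A <= b)%MM /\ (z A)@_(b - smon A) != 0.
Proof.
move=> bz; have Ab := kcoef_neq0 bz; split=> //.
by rewrite -kcoefD submK.
Qed.

Lemma koszul_detected_SR : cocycle_detected k K -> koszul_detected IK.
Proof.
move=> det n z zh zc zm; pose zS := kmap (fun p => SR_val p : S^o) z.
have zSc : kdX zS = 0 by rewrite kd_SR_val zc; apply/ffunP=> A; rewrite !ffunE.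
pose bounded b (c : chain) := supported [pred A : {set 'I_m} |
  (smon A <= b)%MM && (mnm_support (b - smon A)%MM \notin K)] c.
have kb b : bounded b (kcoef b zS).
  move=> A /kcoef_neq0_mcoeff[Ab]; rewrite ffunE /= Ab /=.
  by move: (b - smon A)%MM; apply/stanley_reisnerP/SR_valP.
have kc b : bd (kcoef b zS) = 0.
  by rewrite -kcoef_kd zSc; apply/ffunP=> A; rewrite !ffunE mul0r mcoeff0.
have /boolp.choice[c cE] b : exists c : chain, bounded b c /\ bd c = kcoef b zS.
  have [/existsP[j bj]|b1] := boolP [exists j, (1 < b j)%N].
    exists (kos_wedge j (kcoef b zS)); split; last exact: kd_wedge_cycle.
    move=> A; rewrite ffunE; case: ifP => [jA|]; last by rewrite eqxx.
    rewrite scaler_eq0 negb_or => /andP[_ /kb/andP[/mnm_lepP Ab bA]].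
    apply/andP; split.
      apply/mnm_lepP=> i; have := Ab i; rewrite !mnmE !inE.
      by case: (eqVneq i j) => // -> _; rewrite jA ltnW.
    congr (_ \notin K): bA; apply/setP=> i; rewrite !inE !mnmE !inE.
    case: (eqVneq i j) => // ->; rewrite jA /= subn0 subn_eq0 -ltnNge bj.
    by rewrite -lt0n ltnW.
  pose U := mnm_support b; have bE : b = smon U.
    apply/mnmP=> i; rewrite mnmE inE; move: b1; rewrite negb_exists => /forallP/(_ i).
    by case: (b i) => [|[]].
  have cU : cosupported K U (kcoef b zS).
    move=> A /kb /=; rewrite bE smon_le => /andP[AU]; rewrite /= AU smon_sub //.
    by rewrite support_smon.
  have [|A cA|c' c'U c'E] := det U n _ _ (kc b) cU.
  - apply/ffunP=> A; rewrite !ffunE; case: ifP => // An.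
    by rewrite (khom0 zh) ?An //= mul0r mcoeff0.
  - have [Ab] := kcoef_neq0_mcoeff cA; rewrite ffunE => /(maxideal_SR (zm A))[i].
    have /andP[AU UA] := cU A cA; rewrite bE smon_sub // mnmE.
    case: (boolP (i \in _)) => // iUA _; rewrite /missing_face negb_and.
    rewrite (_ : mnm_support _ = (U :\: A) :\ i) => [iK|].
      apply/orP; right; apply/forallPn; exists ((U :\: A) :\ i).
      by rewrite negb_imply iK properD1.
    apply/setP=> j; rewrite !inE mnmBE mnm1E !mnmE !inE (eq_sym i j).
    by case: (eqVneq j i) => [->|]; rewrite ?subn0 //; case: (_ && _).
  exists c'; split=> // A /c'U /= /andP[AU UA].
  by rewrite bE smon_le AU smon_sub // support_smon.
have [||y yE yc] := @kos_of_components k m zS c.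
- by move=> b; have [] := cE b.
- by move=> b A; have [cb _] := cE b => /cb/andP[].
have [|y' y'E] := @kos_stanley_reisner y.
  move=> A; apply/stanley_reisnerP => b /yc; have [cb _] := cE (b + smon A)%MM.
  by move=> /cb/andP[_]; rewrite addmK.
exists y'; apply: kmap_SR_val_inj; by rewrite -kd_SR_val y'E.
Qed.

Lemma SR_koszul_detected : koszul_detected IK -> cocycle_detected k K.
Proof.
move=> det U n c ch c0 cU cm.
have /boolp.choice[x xE] A : exists x : IK, U :\: A \notin K ->
    SR_val x = 'X_[smon (U :\: A)].
  case: (boolP (U :\: A \notin K)) => [UA|_]; last by exists 0.
  by exists (SRIdeal (stanley_reisner_smon UA)).
pose z : kos IK := [ffun A => (c A : k)%:MP *: x A].
pose zS := kmap (fun p => SR_val p : S^o) z.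
have zSE A : c A != 0 -> zS A = (c A : k)%:MP * 'X_[smon (U :\: A)].
  by move=> cA; have /andP[_ UA] := cU A cA; rewrite !ffunE -(xE A UA).
have zS0 A : c A = 0 -> zS A = 0.
  by move=> cA; rewrite !ffunE cA mpolyC0 scale0r.
have kE b : kcoef b zS = if b == smon U then c else 0.
  apply/ffunP=> A; rewrite ffunE.
  have [cA|cA] := eqVneq (c A) 0.
    by rewrite zS0 // mul0r mcoeff0; case: ifP => // _; rewrite ?cA ?ffunE.
  have /andP[AU UA] := cU A cA.
  rewrite zSE // -mulrA -mpolyXD mcoeffCM mcoeffX -smon_sub // submK ?smon_le //.
  by rewrite eq_sym; case: eqP => _; rewrite ?mulr1 // mulr0 ffunE.
have zc : kdX z = 0.
  apply: kmap_SR_val_inj; rewrite -kd_SR_val.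
  transitivity (0 : kos S^o); last by apply/ffunP=> A; rewrite !ffunE.
  apply: kcoef_inj => b; rewrite kcoef_kd kE.
  transitivity (0 : chain); first by case: eqP; rewrite ?c0 ?linear0.
  by apply/ffunP=> A; rewrite !ffunE mul0r mcoeff0.
have zh : khom n z.
  apply/ffunP=> A; rewrite !ffunE; case: ifP => // /negbT An.
  by rewrite (khom0 ch An) mpolyC0 scale0r.
have [A|y yE] := det n z zh zc.
  rewrite ffunE; have [->|cA] := eqVneq (c A) 0.
    by rewrite mpolyC0 scale0r; apply: maxideal_mul0.
  have /andP[AU UA] := cU A cA; have := cm A cA.
  rewrite /missing_face UA /= => /forallPn[J]; rewrite negb_imply.
  case/andP=> /properP[JUA [i iUA iJ]] JK.
  have UAiK : (U :\: A) :\ i \notin K.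
    have [_ down _] := hK; apply: contra JK => /down; apply.
    by rewrite subsetD1 JUA iJ.
  have -> : x A = vars k i *: (SRIdeal (stanley_reisner_smon UAiK) : IK).
    apply: val_inj; rewrite /= xE //.
    rewrite -[RHS]/('X_i * 'X_[smon ((U :\: A) :\ i)]) -mpolyXD; congr 'X_[_].
    by rewrite -smonU1 ?setD11 // setD1K.
  by rewrite scalerA mulrC -scalerA; apply: maxideal_mulX.
pose yS := kmap (fun p => SR_val p : S^o) y.
exists (kcoef (smon U) yS); last first.
  by rewrite -kcoef_kd kd_SR_val yE -/zS kE eqxx.
move=> A /kcoef_neq0_mcoeff[]; rewrite smon_le => AU; rewrite /= AU smon_sub // ffunE.
have /stanley_reisnerP yK := SR_valP (y A); move=> /yK.
by rewrite support_smon.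
Qed.

End StanleyReisnerKoszul.

Theorem proposition2p4 (k : fieldType) (m : nat) (K : {set {set 'I_m}})
    (hK : simplicial_complex K) :
  quasi_koszul (SR_ideal k K : lmodType {mpoly k[m]}) <-> HMF k K.
Proof.
split=> [/quasi_koszul_detected/(SR_koszul_detected hK)|].
  exact: cocycle_detected_HMF.
move=> /(HMF_cocycle_detected hK)/(koszul_detected_SR hK).
exact: detected_quasi_koszul.
Qed.
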